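(* Let $G$ be an $n$-node digraph with independence number $\alpha$, and let $r$ be a designated root node. For every $p\in\mathbb{N}$ and $k\ge 2$, there is a $p$-pass randomized streaming algorithm that, with probability $1-1/n^{\Omega(1)}$, computes $k$ pairwise arc-disjoint spanning out-branchings of $G$ rooted at $r$ (whenever such out-branchings exist), using (a) $O(k^{1-1/p}\alpha n^{1+1/p}\log n)$ space in the insertion-only model; and (b) $O(k^{1-O(1/\sqrt{p})}\alpha n^{1+O(1/\sqrt{p})}\log n)$ space in the turnstile model.
   Context: All digraphs are simple; the independence number is that of the underlying undirected graph. A spanning out-branching of $G=(V,A)$ rooted at $r$ is a subgraph $T=(V,A')$ in which every node $v\neq r$ has exactly one incoming arc and $r$ has none, and every node is reachable from $r$ in $T$. Graph streaming model: arcs arrive in adversarial order, $p$ forward passes; insertion-only model has only insertions, turnstile allows deletions of previously inserted arcs. Space upper bounds are in words of $O(\log n)$ bits. *)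

(* Defs.v *)
From mathcomp Require Import all_boot all_order all_algebra.
From mathcomp Require Import reals exp.

Set Implicit Arguments.
Unset Strict Implicit.
Unset Printing Implicit Defensive.

Import Order.TTheory GRing.Theory Num.Theory.

Local Open Scope nat_scope.

Definition arc_of (n : nat) := ('I_n * 'I_n)%type.

(* A digraph on the node set 'I_n is its set of arcs. Parallel arcs are thus
   impossible; opposite arcs (u, v) and (v, u) may both be present. *)
Definition digraph (n : nat) := {set arc_of n}.

Definition simple n (G : digraph n) : bool := [forall e in G, e.1 != e.2].

Definition independent n (G : digraph n) (I : {set 'I_n}) : bool :=
  [forall u in I, forall v in I, (u, v) \notin G].

Definition independence_number n (G : digraph n) : nat :=
  \max_(I : {set 'I_n} | independent G I) #|I|.

Definition out_branching n (G : digraph n) (r : 'I_n) (T : {set arc_of n}) : bool :=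
  [&& T \subset G,
      [forall v, #|[set e in T | e.2 == v]| == (v != r)] &
      [forall v, connect [rel x y | (x, y) \in T] r v]].

Definition disjoint_out_branchings n k (G : digraph n) (r : 'I_n)
    (F : {ffun 'I_k -> {set arc_of n}}) : bool :=
  [forall i, out_branching G r (F i)] &&
  [forall i, forall j, (i != j) ==> [disjoint F i & F j]].

(* A randomized streaming algorithm. Its whole memory is [state]: whatever it
   remembers between two steps (sampled coins, the pass number, the answer) has
   to be encoded there. Each step draws a fresh uniform element of [coin]. The
   input [None] announces the beginning of a pass. *)
Record stream_alg (token output : Type) := StreamAlg {
  state : finType;
  coin : finType;
  coin_gt0 : 0 < #|coin|;
  init : state;
  step : option token -> coin -> state -> state;
  result : state -> output }.

(* What is read during p forward passes over the stream s. *)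
Definition passes (token : Type) (p : nat) (s : seq token) : seq (option token) :=
  flatten (nseq p (None :: map Some s)).

Definition run token output (A : stream_alg token output)
    (inputs : seq (option token)) (w : seq (coin A)) : output :=
  result (foldl (fun q ic => step ic.1 ic.2 q) (init A) (zip inputs w)).

Definition success_prob (R : realType) token output
    (A : stream_alg token output) (p : nat) (s : seq token)
    (good : pred output) : R :=
  (#|[set w : (size (passes p s)).-tuple (coin A)
      | good (run (passes p s) w)]|%:R
   / #|{: (size (passes p s)).-tuple (coin A)}|%:R)%R.

(* Number of bits of a machine word, Theta(log n) and positive. *)
Definition word_bits (n : nat) : nat := (trunc_log 2 n).+1.

(* The least m such that m words are enough to encode every state. *)
Definition space_words token output (n : nat)
    (A : stream_alg token output) : nat :=
  (up_log 2 #|state A| + (word_bits n).-1) %/ word_bits n.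

(* Every arc of G arrives exactly once, in an arbitrary order. *)
Definition insertion_stream n (G : digraph n) (s : seq (arc_of n)) : bool :=
  perm_eq s (enum G).

Inductive update (n : nat) := Insert of arc_of n | Delete of arc_of n.

(* The updates s lead from the simple digraph H to G through simple digraphs. *)
Fixpoint updates_to n (G H : digraph n) (s : seq (update n)) : bool :=
  match s with
  | [::] => H == G
  | Insert e :: s' => [&& e.1 != e.2, e \notin H & updates_to G (e |: H) s']
  | Delete e :: s' => (e \in H) && updates_to G (H :\ e) s'
  end.

Definition turnstile_stream n (G : digraph n) (s : seq (update n)) : bool :=
  updates_to G set0 s.

(* The random choices are made after the stream is fixed; nothing is required
   of A on digraphs that do not have k arc-disjoint out-branchings. *)
Definition finds_out_branchings_whp (R : realType) token n k
    (valid : digraph n -> seq token -> bool) (alpha p : nat) (r : 'I_n) (c : R)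
    (A : stream_alg token {ffun 'I_k -> {set arc_of n}}) : Prop :=
  forall (G : digraph n) (s : seq token),
    simple G -> independence_number G = alpha ->
    (exists F : {ffun 'I_k -> {set arc_of n}}, disjoint_out_branchings G r F) ->
    valid G s ->
    (1 - n%:R `^ (- c) <= success_prob R A p s (disjoint_out_branchings G r))%R.

(* Main.v *)
Require Import Defs.
From mathcomp Require Import all_boot all_order all_algebra finfield zify ring lra.
From mathcomp Require Import reals exp.

(* A single linear-sketching algorithm, with exponent 1/p, serves both models.
   Draw a uniformly random order of the vertices and process them greedily: an
   arc at the current vertex is kept unless it is already covered, i.e. unless
   every cut it enters is entered by k kept arcs. All arcs end up covered, so
   the kept arcs satisfy Edmonds' condition as soon as G does.
   If q ranges over k processed vertices with u -> q -> v, then (u, v) is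
   covered. Since a digraph in which all outdegrees are below d has at most
   2 d alpha vertices, exposing the order backwards shows that only
   O(alpha k n log n) arcs are kept, and that once a vertices are processed only
   O(rho alpha k n log n) uncovered arcs touch the first rho a vertices. One
   pass recovers these arcs exactly from power sums over a field of
   characteristic 2, in which insertions and deletions are the same update, and
   so processes the vertices up to rank rho a. Starting from rank k rho, p
   passes are enough when k rho^p >= n, that is, rho = O((n / k)^(1/p)). *)

Set Implicit Arguments.
Unset Strict Implicit.
Unset Printing Implicit Defensive.

Import Order.TTheory GRing.Theory Num.Theory.

Local Open Scope nat_scope.

(** * Random orders *)

(** Enumerating permutations exposes the head first, and the last [a] entries survive that induction
    unchanged. *)
Definition suffix_of (T : Type) (a : nat) (t : seq T) : seq T :=
  drop (size t - a) t.

Lemma suffix_of_cons (T : Type) a (x : T) t :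
  a <= size t -> suffix_of a (x :: t) = suffix_of a t.
Proof. by move=> lea; rewrite /suffix_of /= subSn. Qed.

Lemma suffix_of_suffix (T : Type) a b (t : seq T) :
  a <= b -> suffix_of a (suffix_of b t) = suffix_of a t.
Proof.
by move=> leab; rewrite /suffix_of size_drop drop_drop; congr drop; lia.
Qed.

Lemma suffix_of_size (T : Type) (t : seq T) : suffix_of (size t) t = t.
Proof. by rewrite /suffix_of subnn drop0. Qed.

Lemma size_suffix_of (T : Type) a (t : seq T) :
  a <= size t -> size (suffix_of a t) = a.
Proof. by move=> lea; rewrite /suffix_of size_drop subKn. Qed.

Lemma sum_permutations (T : eqType) (l : seq T) (f : seq T -> nat) :
  uniq l -> 0 < size l ->
  \sum_(t <- permutations l) f t =
  \sum_(x <- l) \sum_(t <- permutations (rem x l)) f (x :: t).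
Proof.
move=> Ul l0; by rewrite (perm_big _ (permutationsE l0)) /= undup_id // big_allpairs_dep.
Qed.

Lemma count_permutations (T : eqType) (l : seq T) (E : pred (seq T)) :
  uniq l -> 0 < size l ->
  count E (permutations l) =
  \sum_(x <- l) count (fun t => E (x :: t)) (permutations (rem x l)).
Proof.
move=> Ul l0; rewrite -sum1_count big_mkcond sum_permutations //=.
by apply: eq_bigr => x _; rewrite -sum1_count [RHS]big_mkcond.
Qed.

Lemma count_rem_le (T : eqType) (B : pred T) x (l : seq T) : x \in l ->
  count B (rem x l) = count B l - B x.
Proof. by move=> xl; rewrite count_rem xl. Qed.

(** The [count B l] elements of [B] go injectively into the [size l - a] positions before the
    suffix, the others anywhere. The induction runs on the number of these positions, splitting on
    whether the head lies in [B]. *)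
Lemma count_has_suffix0 (T : eqType) (B : pred T) a (l : seq T) :
  uniq l -> a <= size l ->
  count (fun t => ~~ has B (suffix_of a t)) (permutations l) =
  (size l - a) ^_ (count B l) * (size l - count B l)`!.
Proof.
move=> + lea; have [d def_d] : {d | size l = d + a} by exists (size l - a); lia.
rewrite def_d addnK; elim: d l def_d {lea} => [|d IHd] l def_l Ul.
  rewrite add0n in def_l *.
  transitivity (count (fun=> ~~ has B l) (permutations l)).
    apply: eq_in_count => t; rewrite mem_permutations => pt.
    by rewrite -{1}def_l -(perm_size pt) suffix_of_size (perm_has B pt).
  case: (boolP (has B l)) => hB /=.
    by move: hB; rewrite has_count; case: (count B l) => // c _; rewrite count_pred0.
  move: hB; rewrite has_count -leqNgt leqn0 => /eqP->.
  by rewrite count_predT size_permutations // def_l subn0 ffactn0 mul1n.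
have l0 : 0 < size l by rewrite def_l.
rewrite count_permutations //.
have cl : count B l <= d.+1 + a by rewrite -def_l count_size.
(* [g c] counts the admissible tails once the head is chosen and [c] elements of [B] are left. *)
pose g (c : nat) := d ^_ c * (d + a - c)`!.
transitivity (\sum_(x <- l) g (count B l - B x)).
  rewrite big_seq [RHS]big_seq; apply: eq_bigr => x xl.
  have sr : size (rem x l) = d + a by rewrite size_rem // def_l.
  have Ur : uniq (rem x l) by rewrite rem_uniq.
  rewrite /g -(count_rem_le B xl) -IHd //.
  apply: eq_in_count => t; rewrite mem_permutations => pt.
  by rewrite suffix_of_cons // (perm_size pt) sr leq_addl.
rewrite (bigID B) /=.
rewrite (eq_bigr (fun=> g (count B l - 1))); last by move=> x ->.
rewrite [X in _ + X](eq_bigr (fun=> g (count B l))); last by move=> x /negbTE->; rewrite subn0.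
rewrite !big_const_seq !iter_addn_0 /g.
have -> : count (fun i => ~~ B i) l = d.+1 + a - count B l.
  by rewrite -def_l -(count_predC B l) addKn.
case: (count B l) cl => [|c] cl.
  by rewrite muln0 !subn0 !ffactn0 add0n !mul1n addSn factS mulnC.
rewrite subn1 /= ffactSS addSn subSS in cl *.
have [ltdc|lecd] := ltnP d c.
  by rewrite ffactnSr ffact_small // !(mul0n, muln0).
rewrite ffactnSr; case def_m: (d + a - c) => [|m].
  have -> : d = c by lia.
  by rewrite muln0 addn0 !muln1 mulnC.
have -> : d + a - c.+1 = m by lia.
have -> : d.+1 = c.+1 + (d - c) by lia.
by rewrite factS; nia.
Qed.

(** Factor by factor, [(u - i) / u <= (v - i) / v] because [u <= v]. *)
Lemma ffact_expn_le c u v : u <= v -> u ^_ c * v ^ c <= u ^ c * v ^_ c.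
Proof.
move=> leuv; elim: c => [|c IHc]; first by rewrite !ffactn0.
rewrite !ffactnSr !expnSr.
have h : (u - c) * v <= u * (v - c).
  by rewrite mulnBl mulnBr leq_sub2l // [u * c]mulnC leq_mul2l leuv orbT.
by have := leq_mul IHc h; rewrite !mulnA; nia.
Qed.

(** As a probability, the bound is [(1 - a / size l) ^ m]. It is first proved with exponent
    [count B l], then weakened to [m]. *)
Lemma count_has_suffix0_le (T : eqType) (B : pred T) a m (l : seq T) :
  uniq l -> a <= size l -> m <= count B l ->
  count (fun t => ~~ has B (suffix_of a t)) (permutations l) * size l ^ m
    <= (size l - a) ^ m * (size l)`!.
Proof.
move=> Ul lea lem; set c := count B l in lem.
case: (posnP (size l)) => [s0 | sgt0].
  have -> : m = 0 by have := count_size B l; rewrite -/c; lia.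
  by rewrite !muln1 mul1n -size_permutations // count_size.
have lec : c <= size l := count_size B l.
have : count (fun t => ~~ has B (suffix_of a t)) (permutations l) * size l ^ c
    <= (size l - a) ^ c * (size l)`!.
  rewrite count_has_suffix0 // -/c mulnAC -(ffact_fact lec) mulnA leq_mul2r.
  by rewrite ffact_expn_le ?leq_subr ?orbT.
rewrite -(subnKC lem) !expnD => h.
rewrite -(leq_pmul2r (_ : 0 < size l ^ (c - m))) ?expn_gt0 ?sgt0 // -mulnA.
apply: leq_trans h _; rewrite -!mulnA leq_mul2l mulnC leq_mul2l.
by case: (c - m) => [|e]; rewrite ?expn0 ?leq_exp2r ?leq_subr ?leqnn ?orbT.
Qed.

(** A suffix with fewer than [k] elements of [A] misses one of [k] disjoint blocks of [beta]
    elements of [A]; the union bound over the blocks gives the factor [k]. *)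
Lemma count_suffix_lt_base (T : eqType) (A : pred T) k beta a (l : seq T) :
  uniq l -> a <= size l -> k * beta <= count A l ->
  count (fun t => count A (suffix_of a t) < k) (permutations l) * size l ^ beta
    <= k * (size l - a) ^ beta * (size l)`!.
Proof.
move=> Ul lea leA; set f := filter A l.
have [->|beta0] := posnP beta.
  rewrite !muln1; case: k leA => [|k] _; last first.
    by rewrite mulSn -size_permutations // (leq_trans (count_size _ _)) ?leq_addr.
  by rewrite (eq_count (a2 := pred0)) ?count_pred0.
(* Blocks are consecutive stretches of [filter A l]; those with index at least [k] hold the
   surplus. *)
pose B (i : nat) : pred T := [pred x | A x && (index x f %/ beta == i)].
have Bge i : i < k -> beta <= count (B i) l.
  move=> ltik.
  have Uf : uniq f by rewrite filter_uniq.
  have -> : count (B i) l = \sum_(x <- f) (index x f %/ beta == i).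
    rewrite -sum1_count [RHS]big_filter big_mkcond [RHS]big_mkcond.
    by apply: eq_bigr => x _; rewrite /B /=; case: (A x) => //=; case: (_ == _).
  have szf : k * beta <= size f by rewrite size_filter.
  have lei : i * beta + beta <= size f by nia.
  have f0 : 0 < size f by lia.
  have x0 : T by move: f0; case: (f) => [|x0].
  rewrite (big_nth x0).
  rewrite (@big_cat_nat _ _ _ (i * beta)) //=; last by nia.
  rewrite [X in _ + X](@big_cat_nat _ _ _ (i * beta + beta)) //=; last by nia.
  rewrite addnCA; apply: leq_trans (leq_addr _ _).
  rewrite big_nat (eq_bigr (fun=> 1)) => [|m /andP[m1 m2]].
    by rewrite -big_nat sum_nat_const_nat; nia.
  rewrite index_uniq //; last by nia.
  by rewrite (_ : m %/ beta == i) //; apply/eqP; nia.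
have hsub t : count A t < k -> has (fun i => ~~ has (B i) t) (iota 0 k).
  apply: contraTT => /hasPn all_hit; rewrite -leqNgt.
  have: \sum_(i < k) 1 <= \sum_(i < k) count (B i) t.
    apply: leq_sum => i _; rewrite -has_count.
    by have := all_hit i; rewrite mem_iota /= negbK; apply.
  rewrite sum1_card card_ord => /leq_trans-> //.
  rewrite (eq_bigr (fun i : 'I_k => \sum_(x <- t) nat_of_bool (B i x))); last first.
    by move=> i _; rewrite -sum1_count big_mkcond; apply: eq_bigr => x _; case: (B i x).
  rewrite exchange_big -sum1_count [X in _ <= X]big_mkcond /=; apply: leq_sum => x _.
  rewrite /B /=; case: (A x) => /=; last by rewrite big1.
  have [ltk|] := ltnP (index x f %/ beta) k.
    rewrite (bigD1 (Ordinal ltk)) //= eqxx big1 // => i.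
    by rewrite eq_sym -val_eqE /= => /negbTE->.
  by move=> gek; rewrite big1 // => i _; case: eqP => // e; have := ltn_ord i; lia.
apply: (@leq_trans (\sum_(i < k) count (fun t => ~~ has (B i) (suffix_of a t)) (permutations l) * size l ^ beta)).
  rewrite -big_distrl leq_mul2r /=; apply/orP; right.
  rewrite -sum1_count big_mkcond.
  rewrite (eq_bigr (fun i : 'I_k => \sum_(t <- permutations l) nat_of_bool (~~ has (B i) (suffix_of a t)))); last first.
    by move=> i _; rewrite -sum1_count big_mkcond; apply: eq_bigr => x _; case: has.
  rewrite exchange_big; apply: leq_sum => t _; case: ifP => // /hsub /hasP[i].
  rewrite mem_iota /= add0n => ltik hi.
  by rewrite (bigD1 (Ordinal ltik)) //= hi.
apply: (@leq_trans (\sum_(i < k) (size l - a) ^ beta * (size l)`!)).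
  by apply: leq_sum => i _; apply: count_has_suffix0_le => //; apply: Bge.
by rewrite sum_nat_const card_ord mulnA.
Qed.

(** Given its set of elements, the suffix of a random permutation is uniformly ordered, so a bound
    valid for every list of [b] elements carries over. *)
Lemma count_suffix_lift (T : eqType) (E : pred (seq T)) b u v (l : seq T) :
  uniq l -> b <= size l ->
  (forall m, uniq m -> size m = b -> count E (permutations m) * u <= v * b`!) ->
  count (fun t => E (suffix_of b t)) (permutations l) * u <= v * (size l)`!.
Proof.
move=> + leb hE; have [d def_d] : {d | size l = d + b} by exists (size l - b); lia.
elim: d l def_d {leb} => [|d IHd] l def_l Ul.
  rewrite add0n in def_l; rewrite def_l -[_ * u](_ : count E (permutations l) * u = _); first exact: hE.
  congr (_ * _); apply: eq_in_count => t; rewrite mem_permutations => pt.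
  by rewrite -def_l -(perm_size pt) suffix_of_size.
rewrite count_permutations //; last by rewrite def_l.
rewrite big_distrl /= def_l addSn factS mulnCA.
apply: (@leq_trans (\sum_(x <- l) v * (d + b)`!)); last first.
  by rewrite big_const_seq iter_addn_0 count_predT def_l addSn mulnC.
rewrite big_seq [X in _ <= X]big_seq; apply: leq_sum => x xl.
have sr : size (rem x l) = d + b by rewrite size_rem // def_l.
rewrite -sr; apply: leq_trans (IHd _ sr (rem_uniq _ Ul)).
rewrite leq_mul2r; apply/orP; right; rewrite leq_eqVlt; apply/orP; left; apply/eqP.
apply: eq_in_count => t; rewrite mem_permutations => pt.
by rewrite suffix_of_cons // (perm_size pt) sr leq_addl.
Qed.

(* Among the last b elements, the (at least k * beta) elements of A fall into k
   blocks of size beta, one of which misses the last a elements. *)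
Lemma count_suffix_lt (T : eqType) (A : pred T) k beta a b (l : seq T) :
  uniq l -> a <= b -> b <= size l ->
  count (fun t => (k * beta <= count A (suffix_of b t)) &&
                  (count A (suffix_of a t) < k)) (permutations l) * b ^ beta
    <= k * (b - a) ^ beta * (size l)`!.
Proof.
move=> Ul leab leb.
pose E (t : seq T) := (k * beta <= count A t) && (count A (suffix_of a t) < k).
rewrite (eq_count (a2 := fun t => E (suffix_of b t))); last first.
  by move=> t; rewrite /E suffix_of_suffix.
apply: count_suffix_lift => // m Um szm.
have [leA|ltA] := leqP (k * beta) (count A m); last first.
  rewrite (@eq_in_count _ _ pred0) ?count_pred0 // => t.
  by rewrite mem_permutations /E => /permP->; rewrite leqNgt ltA.
have := count_suffix_lt_base Um _ leA; rewrite szm => /(_ a leab); apply: leq_trans.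
rewrite leq_mul2r; apply/orP; right; apply: sub_count => t.
by case/andP.
Qed.

(** The induction step is Bernoulli's inequality [1 + D / (m + 1) <= (1 + 1 / (m + 1)) ^ D]. *)
Lemma prod_add_le m D : \prod_(j < m) (j.+1 + D) <= m`! * m.+1 ^ D.
Proof.
elim: m => [|m IHm]; first by rewrite big_ord0 exp1n.
rewrite big_ord_recr /= factS.
suff h : (m.+1 + D) * m.+1 ^ D <= m.+1 * m.+2 ^ D.
  apply: leq_trans (leq_mul IHm (leqnn _)) _.
  by rewrite -mulnA [m.+1 * _]mulnC -[X in _ <= X]mulnA leq_mul2l [m.+1 ^ D * _]mulnC h orbT.
elim: D {IHm} => [|D IHD]; first by rewrite !muln1 addn0.
rewrite !expnS.
have h : (m.+1 + D.+1) * m.+1 <= m.+2 * (m.+1 + D) by nia.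
have := leq_mul (leqnn (m.+1 ^ D)) h; have := leq_mul (leqnn m.+2) IHD.
by nia.
Qed.

(* Reading the order from its latest element backwards, each step adds one to Z
   with probability at most D / size, whatever happened before. *)
Lemma sum_expn_permutations (T : eqType) (Z : seq T -> nat)
    (b : T -> seq T -> bool) D (l : seq T) :
  Z [::] = 0 -> (forall x t, Z (x :: t) = b x t + Z t) ->
  (forall x s t, perm_eq s t -> b x s = b x t) ->
  (forall m, uniq m -> {subset m <= l} -> count (fun x => b x (rem x m)) m <= D) ->
  uniq l ->
  \sum_(t <- permutations l) 2 ^ Z t <= \prod_(j < size l) (j.+1 + D).
Proof.
move=> Z0 ZS bP bD; move def_m: (size l) => m.
elim: m l def_m bD => [|m IHm] l def_l bD Ul.
  by rewrite (size0nil def_l) big_ord0 big_seq1 Z0.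
rewrite sum_permutations ?def_l //.
pose P := \prod_(j < m) (j.+1 + D).
apply: (@leq_trans (\sum_(x <- l) (1 + b x (rem x l)) * P)).
  rewrite big_seq [X in _ <= X]big_seq; apply: leq_sum => x xl.
  have sr : size (rem x l) = m by rewrite size_rem // def_l.
  apply: (@leq_trans ((1 + b x (rem x l)) * \sum_(t <- permutations (rem x l)) 2 ^ Z t)).
    rewrite big_distrr /= big_seq [X in _ <= X]big_seq; apply: leq_sum => t.
    rewrite mem_permutations => pt; rewrite ZS (bP _ _ _ pt) expnD.
    by case: (b x _).
  rewrite leq_mul2l; apply/orP; right; apply: IHm; rewrite ?rem_uniq //.
  by move=> m' Um sm; apply: bD => // y /sm /mem_rem.
rewrite -big_distrl /= big_ord_recr /= mulnC leq_mul2l; apply/orP; right.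
rewrite big_split /= sum1_size def_l leq_add2l.
rewrite (_ : \sum_(x <- l) _ = count (fun x => b x (rem x l)) l) ?bD //.
by rewrite -sum1_count [RHS]big_mkcond; apply: eq_bigr => x _; case: (b x _).
Qed.

(** Markov's inequality for [2 ^ Z], whose mean is at most [(size l + 1) ^ D <= 2 ^ (D * e)]. *)
Lemma count_tail_permutations (T : eqType) (Z : seq T -> nat)
    (b : T -> seq T -> bool) D e c (l : seq T) :
  Z [::] = 0 -> (forall x t, Z (x :: t) = b x t + Z t) ->
  (forall x s t, perm_eq s t -> b x s = b x t) ->
  (forall m, uniq m -> {subset m <= l} -> count (fun x => b x (rem x m)) m <= D) ->
  uniq l -> size l < 2 ^ e ->
  count (fun t => (D + c) * e <= Z t) (permutations l) * 2 ^ (c * e)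
    <= (size l)`!.
Proof.
move=> Z0 ZS bP bD Ul lt_e.
have := leq_trans (sum_expn_permutations Z0 ZS bP bD Ul) (prod_add_le _ _).
have h1 : (size l).+1 ^ D <= 2 ^ (D * e).
  by rewrite mulnC expnM; case: (D) => // D'; rewrite leq_exp2r.
move=> h2; have {h1 h2} := leq_trans h2 (leq_mul (leqnn _) h1) => h.
rewrite -(leq_pmul2r (_ : 0 < 2 ^ (D * e))) ?expn_gt0 //; apply: leq_trans h.
rewrite -mulnA -expnD -mulnDl [c + D]addnC -sum1_count big_distrl /=.
rewrite big_mkcond; apply: leq_sum => t _; case: ifP => // le_Z.
by rewrite mul1n leq_exp2l.
Qed.

(** * Independence number and Edmonds' branching theorem *)

Lemma card_sum_mem (T : finType) (A : {set T}) (P : pred T) :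
  #|[set x in A | P x]| = \sum_(x in A) P x.
Proof.
rewrite -sum1_card big_mkcond [RHS]big_mkcond; apply: eq_bigr => x _.
by rewrite inE; case: (x \in A) => //=; case: (P x).
Qed.

(** Indegrees and outdegrees in [U] have equal sums, so some vertex has both below [delta]. Put it
    into [I], delete it with its neighbours, at most [2 * delta] vertices in all, and repeat. *)
Lemma sparse_independent (T : finType) (R : rel T) delta (U : {set T}) :
  (forall w, w \in U -> #|[set v in U | R w v]| < delta) ->
  exists I : {set T},
    [/\ I \subset U, {in I &, forall u v, u != v -> ~~ R u v}
      & #|U| <= #|I| * delta.*2].
Proof.
have [m] := ubnP #|U|; elim: m U => // m IHm U ltU low.
have [->|[w0 w0U]] := set_0Vmem U.
  by exists set0; rewrite cards0; split=> // x y; rewrite inE.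
have [w wU ltin] : exists2 w, w \in U & #|[set v in U | R v w]| < delta.
  apply/exists_inP; rewrite -[X in is_true X]negbK negb_exists_in; apply/negP => /forall_inP high.
  have : \sum_(w in U) delta <= \sum_(w in U) #|[set v in U | R v w]|.
    by apply: leq_sum => w /high; rewrite -leqNgt.
  rewrite [X in _ <= X](eq_bigr (fun w => \sum_(v in U) nat_of_bool (R v w))); last by move=> w _; exact: card_sum_mem.
  rewrite exchange_big /= leqNgt => /negP[].
  rewrite (bigD1 w0) //= [X in _ < X](bigD1 w0) //= -addSn leq_add //.
    by rewrite -card_sum_mem low.
  by apply: leq_sum => v /andP[vU _]; rewrite -card_sum_mem ltnW // low.
pose N := w |: ([set v in U | R w v] :|: [set v in U | R v w]).
have cardN : #|N| <= delta.*2.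
  have := low w wU; have := cardsU1 w ([set v in U | R w v] :|: [set v in U | R v w]).
  have := (leq_card_setU [set v in U | R w v] [set v in U | R v w]).1.
  by rewrite -/N -addnn; case: (w \notin _) => /=; lia.
have ltU' : #|U :\: N| < m.
  rewrite -ltnS; apply: leq_trans ltU; rewrite ltnS; apply: proper_card; apply/properP; split; first exact: subsetDl.
  by exists w => //; rewrite !inE eqxx.
have [|I [sIU indI leU]] := IHm (U :\: N) ltU'.
  move=> v; rewrite inE => /andP[_ vU]; apply: leq_ltn_trans (low v vU).
  by apply: subset_leq_card; apply/subsetP => x; rewrite !inE => /andP[/andP[_ ->] ->].
have notN v : v \in I -> v \notin N by move/(subsetP sIU); rewrite inE => /andP[].
have inU v : v \in I -> v \in U by move/(subsetP sIU); rewrite inE => /andP[].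
have wI : w \notin I by apply/negP => /notN; rewrite !inE eqxx.
exists (w |: I); split.
- by rewrite subUset sub1set wU (subset_trans sIU) ?subsetDl.
- move=> u v; rewrite !inE => /orP[/eqP->|uI] /orP[/eqP->|vI]; rewrite ?eqxx // => neq.
  + by move: (notN v vI); rewrite !inE (inU v vI) !negb_or => /and3P[].
  + by move: (notN u uI); rewrite !inE (inU u uI) !negb_or => /and3P[].
  + exact: indI.
rewrite cardsU1 wI mulnDl mul1n.
have := cardsID N U; have := subset_leq_card (subsetIr U N); lia.
Qed.

Lemma simple_irrefl n (G : digraph n) u : simple G -> (u, u) \notin G.
Proof. by move/forall_inP => h; apply/negP => /h; rewrite eqxx. Qed.

Lemma independent_le n (G : digraph n) (I : {set 'I_n}) :
  simple G -> {in I &, forall u v, u != v -> (u, v) \notin G} ->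
  #|I| <= independence_number G.
Proof.
move=> sG hI; apply: (@leq_bigmax_cond _ (independent G) (fun I : {set 'I_n} => #|I|)).
apply/forall_inP => u uI; apply/forall_inP => v vI.
by have [->|/hI] := eqVneq u v; [apply: simple_irrefl | apply].
Qed.

Lemma low_outdegree_card n (G : digraph n) delta (U : {set 'I_n}) :
  simple G -> (forall w, w \in U -> #|[set v in U | (w, v) \in G]| < delta) ->
  #|U| <= independence_number G * delta.*2.
Proof.
move=> sG /sparse_independent[I [_ hI /leq_trans]]; apply.
by rewrite leq_mul2r independent_le ?orbT.
Qed.

Lemma low_indegree_card n (G : digraph n) delta (U : {set 'I_n}) :
  simple G -> (forall w, w \in U -> #|[set v in U | (v, w) \in G]| < delta) ->
  #|U| <= independence_number G * delta.*2.
Proof.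
move=> sG /(@sparse_independent _ (fun w v => (v, w) \in G))[I [_ hI /leq_trans]]; apply.
rewrite leq_mul2r independent_le ?orbT // => u v uI vI neq.
by apply: hI => //; rewrite eq_sym.
Qed.

Lemma independence_number_gt0 n (G : digraph n) (r : 'I_n) :
  simple G -> 0 < independence_number G.
Proof.
move=> sG; rewrite -(cards1 r); apply: independent_le => // u v.
by rewrite !inE => /eqP-> /eqP->; rewrite eqxx.
Qed.

Definition din n (D : digraph n) (X : {set 'I_n}) : nat :=
  #|[set e in D | (e.1 \notin X) && (e.2 \in X)]|.

Lemma din_sum n (D : digraph n) (X : {set 'I_n}) :
  din D X = \sum_(e in D) ((e.1 \notin X) && (e.2 \in X)).
Proof. exact: card_sum_mem. Qed.

Lemma din_submod n (D : digraph n) (X Y : {set 'I_n}) :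
  din D (X :&: Y) + din D (X :|: Y) <= din D X + din D Y.
Proof.
rewrite !din_sum -!big_split /=; apply: leq_sum => e _; rewrite !inE.
by case: (e.1 \in X); case: (e.1 \in Y); case: (e.2 \in X); case: (e.2 \in Y).
Qed.

Lemma din_mono n (D E : digraph n) (X : {set 'I_n}) : D \subset E -> din D X <= din E X.
Proof.
move=> sDE; apply: subset_leq_card; apply/subsetP => e.
by rewrite !inE => /andP[/(subsetP sDE)->].
Qed.

(** The cut condition in Edmonds' theorem. *)
Definition rooted_conn n k (D : digraph n) (r : 'I_n) : Prop :=
  forall X : {set 'I_n}, X != set0 -> r \notin X -> k <= din D X.

(** An out-branching of the vertex set [S] only, to be grown until [S] is everything. *)
Definition partial_branching n (D : digraph n) (r : 'I_n) (S : {set 'I_n})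
    (T : digraph n) : Prop :=
  [/\ r \in S, T \subset D,
      (forall v, #|[set e in T | e.2 == v]| = (v \in S) && (v != r)) &
      (forall v, v \in S -> connect [rel x y | (x, y) \in T] r v)].

Lemma partial_branching_head n (D : digraph n) r S T e :
  partial_branching D r S T -> e \in T -> e.2 \in S.
Proof.
case=> _ _ hdeg _ eT; move: (hdeg e.2); case: (e.2 \in S) => //= /eqP.
by rewrite cards_eq0 => /eqP/setP/(_ e); rewrite !inE eT eqxx.
Qed.

Lemma din_outside n (D : digraph n) r S T (X : {set 'I_n}) :
  partial_branching D r S T -> [disjoint X & S] -> din (D :\: T) X = din D X.
Proof.
move=> pb /disjoint_setI0 XS0; congr #|pred_of_set _|; apply/setP => e; rewrite !inE.
case: (boolP (e \in T)) => //= /(partial_branching_head pb) e2S.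
case e2X: (e.2 \in X); last by rewrite !andbF.
by move/setP/(_ e.2): XS0; rewrite !inE e2X e2S.
Qed.

(* Lovasz: the arc is chosen to enter X \ S without entering X, where X is a
   minimal tight set not inside S; submodularity then shows that no tight set
   loses an arc. *)
Lemma partial_branching_extend n k (D : digraph n) r S T :
  rooted_conn k.+1 D r -> partial_branching D r S T -> rooted_conn k (D :\: T) r ->
  S != setT ->
  exists e, [/\ e \in D :\: T, e.1 \in S, e.2 \notin S & rooted_conn k (D :\: (e |: T)) r].
Proof.
move=> cD pb cDT nS; have [rS sTD hdeg hconn] := pb.
(* Admitting [setT] guarantees a minimal critical set even if no set is tight. *)
pose crit (X : {set 'I_n}) := ~~ (X \subset S) && ((X == setT) || (r \notin X) && (din (D :\: T) X == k)).
have critT : crit setT by rewrite /crit eqxx subTset andbT.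
have [X /minsetP[critX minX] _] := minset_exists critT.
(* No arc of [T] enters [X :\: S], so more than [k] arcs of [D :\: T] do; at most [k] of them enter
   [X], hence one starts in [X :&: S]. *)
have [e [eDT e1X e1S e2X e2S]] : exists e : arc_of n,
    [/\ e \in D :\: T, e.1 \in X, e.1 \in S, e.2 \in X & e.2 \notin S].
  have XS0 : X :\: S != set0 by rewrite setD_eq0; case/andP: critX.
  have rXS : r \notin X :\: S by rewrite inE rS.
  have dXS : k < din (D :\: T) (X :\: S).
    rewrite (din_outside pb) ?cD //.
    by rewrite disjoints_subset subsetDr.
  have dX : din (D :\: T) X <= k.
    case/andP: critX => _ /orP[/eqP->|/andP[_ /eqP->]] //.
    by rewrite din_sum big1 // => f _; rewrite inE.
  have /subsetPn[e] : ~~ ([set e in D :\: T | (e.1 \notin X :\: S) && (e.2 \in X :\: S)]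
      \subset [set e in D :\: T | (e.1 \notin X) && (e.2 \in X)]).
    by apply/negP => /subset_leq_card; rewrite leqNgt (leq_ltn_trans dX).
  rewrite inE => /andP[eDT /andP[h1]]; rewrite in_setD => /andP[e2S e2X].
  rewrite inE negb_and eDT e2X /= andbT negbK => e1X; exists e; split=> //.
  by move: h1; rewrite inE e1X andbT negbK.
exists e; split=> // Y Y0 rY.
have -> : D :\: (e |: T) = (D :\: T) :\ e.
  by apply/setP => f; rewrite !inE negb_or andbA.
case: (boolP ((e.1 \notin Y) && (e.2 \in Y))) => [/andP[e1Y e2Y]|eY]; last first.
  rewrite (_ : din _ Y = din (D :\: T) Y) ?cDT //; congr #|pred_of_set _|.
  apply/setP => f; rewrite !inE; have [->|//] := eqVneq f e.
  by rewrite (negbTE eY) !andbF.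
have : k < din (D :\: T) Y.
  rewrite ltn_neqAle cDT // andbT; apply/negP => /eqP tight.
  have v_cap : e.2 \in X :&: Y by rewrite inE e2X.
  have cap_nS : ~~ (X :&: Y \subset S).
    by apply/negP => /subsetP/(_ _ v_cap); rewrite (negbTE e2S).
  have r_cap : r \notin X :&: Y by rewrite inE (negbTE rY) andbF.
  suff capcrit : crit (X :&: Y).
    have := minX _ capcrit (subsetIl _ _) => /setP/(_ e.1).
    by rewrite inE e1X (negbTE e1Y).
  rewrite /crit cap_nS r_cap /=; apply/orP; right.
  have cap0 : X :&: Y != set0 by apply/set0Pn; exists e.2.
  rewrite eqn_leq cDT // andbT.
  case/andP: critX => _ /orP[/eqP->|/andP[rX /eqP tightX]]; first by rewrite setTI -tight.
  have cup : k <= din (D :\: T) (X :|: Y).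
    by apply: cDT; [apply/set0Pn; exists e.2; rewrite inE e2X | rewrite inE negb_or rX].
  have := din_submod (D :\: T) X Y; rewrite tightX -tight => h.
  by rewrite -(leq_add2r k); apply: leq_trans (leq_add (leqnn _) cup) h.
move=> lt; rewrite -ltnS; apply: leq_trans lt _.
rewrite /din [X in X <= _](cardsD1 e) inE eDT e1Y e2Y /= add1n ltnS; apply: subset_leq_card; apply/subsetP => f.
by rewrite !inE => /andP[-> /andP[/andP[-> ->] ->]].
Qed.

(** Starting from the root alone, the extension step adds one vertex at a time while what remains of
    [D] stays [k]-connected from [r]. *)
Lemma out_branching_exists n k (D : digraph n) r :
  rooted_conn k.+1 D r ->
  exists2 T, out_branching D r T & rooted_conn k (D :\: T) r.
Proof.
move=> cD.
suff main S T : partial_branching D r S T -> rooted_conn k (D :\: T) r ->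
    exists2 T, partial_branching D r setT T & rooted_conn k (D :\: T) r.
  have [||T [_ sT hdeg hconn] cT] := main [set r] set0.
  - split; rewrite ?inE ?sub0set // => v.
      by rewrite setIdE set0I cards0 !inE; case: eqP.
    by rewrite inE => /eqP->; apply: connect0.
  - by move=> X X0 rX; rewrite setD0; apply: leq_trans (cD X X0 rX).
  exists T => //; apply/and3P; split=> //.
    by apply/forallP => v; rewrite hdeg inE.
  by apply/forallP => v; apply: hconn; rewrite inE.
have [m] := ubnP #|~: S|; elim: m S T => // m IHm S T ltm pb cT.
have [ST|nST] := eqVneq S setT; first by exists T; rewrite -?ST.
have [e [eDT e1S e2S cT']] := partial_branching_extend cD pb cT nST.
move: eDT; rewrite inE => /andP[eT eD].
have [rS sTD hdeg hconn] := pb.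
apply: (IHm (e.2 |: S) (e |: T)) => //.
  rewrite -ltnS; apply: leq_trans ltm; rewrite ltnS.
  rewrite setCU -setDE [X in _ < X](cardsD1 e.2) inE e2S add1n ltnS.
  by apply: subset_leq_card; apply/subsetP => x; rewrite !inE => /andP[-> ->].
have hsub : subrel [rel x y | (x, y) \in T] [rel x y | (x, y) \in e |: T].
  by move=> x y /=; rewrite inE orbC => ->.
split; first by rewrite inE rS orbT.
- by rewrite subUset sub1set eD.
- move=> v; have := hdeg v; rewrite !inE.
  have [->|neq] := eqVneq v e.2.
    rewrite (negbTE e2S) /= => /eqP; rewrite cards_eq0 => /eqP T0.
    rewrite (_ : [set f in e |: T | f.2 == e.2] = [set e]).
      by rewrite cards1; case: eqP => // e2r; rewrite e2r rS in e2S.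
    apply/setP => f; rewrite !inE; case: eqP => [->|_] /=; first by rewrite eqxx.
    by move/setP/(_ f): T0; rewrite !inE.
  move=> <-; congr #|pred_of_set _|; apply/setP => f; rewrite !inE.
  by case: eqP => // -> /=; rewrite eq_sym (negbTE neq) andbF.
- have mono v : v \in S -> connect [rel x y | (x, y) \in e |: T] r v.
    by move/hconn; apply: connect_sub => x y xy; apply: connect1; apply: hsub.
  move=> v; rewrite inE => /orP[|/mono//]; rewrite inE => /eqP->.
  apply: connect_trans (mono _ e1S) _; apply: connect1 => /=.
  by rewrite -surjective_pairing !inE eqxx.
Qed.

Lemma out_branching_mono n (D E : digraph n) r T :
  D \subset E -> out_branching D r T -> out_branching E r T.
Proof.
by move=> sDE /and3P[sT h1 h2]; apply/and3P; split=> //; apply: subset_trans sDE.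
Qed.

Lemma edmonds_branchings n k (D : digraph n) r :
  rooted_conn k D r ->
  exists F : {ffun 'I_k -> {set arc_of n}}, disjoint_out_branchings D r F.
Proof.
elim: k D => [|k IHk] D cD.
  by exists [ffun _ => set0]; apply/andP; split; apply/forallP => -[].
have [T brT cT] := out_branching_exists cD.
have [F /andP[/forallP brF /forallP disF]] := IHk _ cT.
have sFD i : F i \subset D :\: T by case/and3P: (brF i).
exists [ffun i => if unlift ord0 i is Some j then F j else T].
apply/andP; split; apply/forallP => i.
  rewrite ffunE; case: unliftP => [j _|_] //.
  by apply: out_branching_mono (brF j); apply: subsetDl.
apply/forallP => j; apply/implyP; rewrite !ffunE.
have TF l : [disjoint T & F l].
  rewrite disjoint_sym disjoints_subset; apply: subset_trans (sFD l) _.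
  by rewrite setDE subsetIr.
case: unliftP => [i' ->|->]; case: unliftP => [j' ->|->] // neq.
  have /forallP/(_ j')/implyP := disF i'; apply.
  by apply: contra_neq neq => ->.
by rewrite disjoint_sym.
Qed.

Lemma connect_enters (T : finType) (e : rel T) (X : {set T}) x y :
  connect e x y -> x \notin X -> y \in X -> exists u v, [/\ e u v, u \notin X & v \in X].
Proof.
move=> /connectP[p]; elim: p x => [|z p IHp] x /=.
  by move=> _ -> /negbTE->.
move=> /andP[xz pz] def_y xX yX; case: (boolP (z \in X)) => zX; first by exists x, z.
exact: IHp pz def_y zX yX.
Qed.

(** The easy half of Edmonds' theorem: each branching has an arc entering [X], and disjointness
    makes these arcs distinct. *)
Lemma branchings_rooted_conn n k (D : digraph n) r (F : {ffun 'I_k -> {set arc_of n}}) :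
  disjoint_out_branchings D r F -> rooted_conn k D r.
Proof.
move=> /andP[/forallP brF /forallP disF] X /set0Pn[y yX] rX.
pose E i := [set e in F i | (e.1 \notin X) && (e.2 \in X)].
have /fin_all_exists[f hf] i : exists e, e \in E i.
  case/and3P: (brF i) => _ _ /forallP/(_ y) conn.
  have [u [v [/= uv uX vX]]] := connect_enters conn rX yX.
  by exists (u, v); rewrite !inE uv uX vX.
have finj : injective f.
  move=> i j eqf; apply/eqP; apply: contraT => neq.
  have /forallP/(_ j)/implyP/(_ neq) := disF i.
  move/disjoint_setI0/setP/(_ (f i)); rewrite !inE.
  have := hf i; have := hf j; rewrite -eqf !inE.
  by move=> /andP[-> _] /andP[-> _].
rewrite -[k in k <= _]card_ord -(card_codom finj) /din.
apply: subset_leq_card; apply/subsetP => e /codomP[i ->].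
have := hf i; rewrite !inE => /andP[fi ->]; rewrite andbT.
by case/and3P: (brF i) => /subsetP sF _ _; apply: sF.
Qed.

(** * Covered arcs and the greedy certificate *)

Definition enters n (X : {set 'I_n}) (e : arc_of n) : bool :=
  (e.1 \notin X) && (e.2 \in X).

(** A kept arc may enter a cut with fewer than [k] kept arcs, hence the first alternative. *)
Definition covered n k (K : digraph n) (e : arc_of n) : bool :=
  (e \in K) || [forall X : {set 'I_n}, enters X e ==> (k <= din K X)].

Definition touches n (S : seq 'I_n) (e : arc_of n) : bool :=
  (e.1 \in S) || (e.2 \in S).

Definition greedy_add n k (G : digraph n) (w : 'I_n) (K : digraph n) : digraph n :=
  K :|: [set e in G | touches [:: w] e && ~~ covered k K e].

(* An order is stored in reverse: the head of t is processed last, and the first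
   a vertices processed are suffix_of a t. *)
Definition greedy n k (G : digraph n) (t : seq 'I_n) (K : digraph n) : digraph n :=
  foldr (greedy_add k G) K t.

(** What a pass must recover: as covered arcs stay covered, [greedy] started from [K] can add only
    these arcs along [t]. *)
Definition pass_arcs n k (G : digraph n) (t : seq 'I_n) (K : digraph n) : digraph n :=
  [set e in G | touches t e && ~~ covered k K e].

Definition midpoints n (G : digraph n) (e : arc_of n) : pred 'I_n :=
  [pred q | ((e.1, q) \in G) && ((q, e.2) \in G)].

Lemma covered_mono n k (K L : digraph n) e : K \subset L -> covered k K e -> covered k L e.
Proof.
move=> sKL /orP[/(subsetP sKL) eL|/forallP h]; rewrite /covered ?eL //.
apply/orP; right; apply/forallP => X; apply/implyP => eX.
by apply: leq_trans (din_mono X sKL); move: (h X); rewrite eX.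
Qed.

Lemma greedy_sup n k (G : digraph n) t (K : digraph n) : K \subset greedy k G t K.
Proof.
elim: t => //= w t IHt; apply: subset_trans IHt _; exact: subsetUl.
Qed.

Lemma greedy_sub n k (G : digraph n) t (K : digraph n) : K \subset G -> greedy k G t K \subset G.
Proof.
move=> sKG; elim: t => //= w t IHt; rewrite subUset IHt.
by apply/subsetP => e; rewrite inE => /andP[].
Qed.

Lemma greedy_covers n k (G : digraph n) t K e :
  e \in G -> touches t e -> covered k (greedy k G t K) e.
Proof.
move=> eG; elim: t => [|w t IHt] //= te.
have : touches [:: w] e || touches t e.
  by move: te; rewrite /touches !inE; do 2 case: (_ == w); rewrite ?orbT.
case/orP => [tw|/IHt]; last by apply: covered_mono; apply: subsetUl.
case: (boolP (covered k (greedy k G t K) e)) => [|nc].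
  by apply: covered_mono; apply: subsetUl.
by rewrite /covered !inE eG tw nc orbT.
Qed.

(** An arc added at any later step was already uncovered by [K], so it is among the recovered arcs.
    In the application, [t] holds the vertices processed in earlier passes. *)
Lemma greedy_pass n k (G : digraph n) s t K :
  greedy k (pass_arcs k G (s ++ t) K) s K = greedy k G s K.
Proof.
have main u s' : s = u ++ s' ->
    greedy k (pass_arcs k G (s ++ t) K) s' K = greedy k G s' K.
  elim: s' u => //= w s' IHs u def_s.
  rewrite (IHs (rcons u w)) ?cat_rcons // /greedy_add; congr (_ :|: _).
  apply/setP => e; rewrite !inE.
  case eG: (e \in G) => //=; case tw: (touches [:: w] e) => //=; last by rewrite andbF.
  case: (boolP (covered k (greedy k G s' K) e)) => nc; first by rewrite andbF.
  rewrite /= andbT; apply/andP; split; last first.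
    by apply: contra nc; apply: covered_mono; apply: greedy_sup.
  move: tw; rewrite /touches !inE def_s !mem_cat !inE.
  by case/orP => ->; rewrite !orbT.
exact: (main [::]).
Qed.

(** Let [e] enter [X]. If an arc touching [t] enters [X] and is not kept, being covered it already
    provides [k] kept arcs. Otherwise each midpoint [q] in [t] provides a kept arc entering [X]: the
    one into [q] or the one out of it, depending on the side of [q]. *)
Lemma covered_midpoints n k (G K : digraph n) t e :
  simple G -> uniq t ->
  (forall f, f \in G -> touches t f -> covered k K f) ->
  k <= count (midpoints G e) t -> covered k K e.
Proof.
move=> sG Ut cov le_k; apply/orP; right; apply/forallP => X; apply/implyP => /andP[e1X e2X].
have [/exists_inP[f fG /and3P[tf fX fK]]|] :=
  boolP [exists f in G, [&& touches t f, enters X f & f \notin K]].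
  by move: (cov f fG tf); rewrite /covered (negbTE fK) /= => /forallP/(_ X); rewrite fX.
rewrite negb_exists_in => /forall_inP inK.
pose g q := if q \in X then (e.1, q) else (q, e.2).
have qP q : q \in filter (midpoints G e) t ->
    [/\ q \in t, (e.1, q) \in G & (q, e.2) \in G].
  by rewrite mem_filter => /andP[/andP[]].
have gG q : q \in filter (midpoints G e) t -> (g q \in K) && enters X (g q).
  move=> /qP[qt q1 q2]; rewrite /g; case: ifP => qX.
    have := inK _ q1; rewrite /enters /touches /= qt qX e1X orbT /= negbK => ->.
    by [].
  have := inK _ q2; rewrite /enters /touches /= qt qX e2X /= negbK => ->.
  by [].
(* A collision between the two cases would identify a midpoint with an endpoint of [e] and create a
   loop. *)
have ginj : {in filter (midpoints G e) t &, injective g}.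
  move=> q q' /qP[_ q1 q2] /qP[_ q1' q2']; rewrite /g.
  case: ifP => qX; case: ifP => q'X [] //.
    by move=> _ eq; move: q2; rewrite eq (negbTE (simple_irrefl _ sG)).
  by move=> _ eq; move: q2'; rewrite -eq (negbTE (simple_irrefl _ sG)).
rewrite -size_filter in le_k; apply: leq_trans le_k _.
rewrite -(size_map g) /din cardE; apply: uniq_leq_size.
  by rewrite map_inj_in_uniq ?filter_uniq.
by move=> f /mapP[q /gG h ->]; rewrite mem_enum inE.
Qed.

Lemma card_by_snd (S T : finType) (A : {set S * T}) :
  #|A| = \sum_(x : T) #|[set w | (w, x) \in A]|.
Proof.
rewrite -sum1_card big_mkcond /= (eq_bigr (fun x => \sum_(w : S) nat_of_bool ((w, x) \in A))).
  rewrite exchange_big pair_big /=; apply: eq_bigr => -[u v] _ /=.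
  by case: (_ \in A).
move=> x _; rewrite -sum1_card big_mkcond; apply: eq_bigr => w _; rewrite inE.
by case: (_ \in A).
Qed.

Lemma card_by_fst (S T : finType) (A : {set S * T}) :
  #|A| = \sum_(x : S) #|[set w | (x, w) \in A]|.
Proof.
rewrite -sum1_card big_mkcond /= (eq_bigr (fun x => \sum_(w : T) nat_of_bool ((x, w) \in A))).
  rewrite pair_big /=; apply: eq_bigr => -[u v] _ /=.
  by case: (_ \in A).
move=> x _; rewrite -sum1_card big_mkcond; apply: eq_bigr => w _; rewrite inE.
by case: (_ \in A).
Qed.

Lemma card_le_count (T : finType) (A : {set T}) (P : pred T) (t : seq T) :
  (forall x, x \in A -> (x \in t) && P x) -> #|A| <= count P t.
Proof.
move=> h; rewrite -size_filter cardE; apply: uniq_leq_size (enum_uniq _) _ => x.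
by rewrite mem_enum mem_filter => /h /andP[-> ->].
Qed.

(** Fix the head [x] and consider the tails [w] in [t]. An arc from one such tail to another makes
    the latter a midpoint of [(w, x)], so these tails span outdegrees below [delta]. Fixed tails are
    symmetric. *)
Lemma card_few_midpoints n (G : digraph n) delta (t : seq 'I_n) :
  simple G ->
  #|[set e in G | touches t e && (count (midpoints G e) t < delta)]|
    <= n * (independence_number G * delta.*2).*2.
Proof.
move=> sG.
pose A1 := [set e in G | (e.1 \in t) && (count (midpoints G e) t < delta)].
pose A2 := [set e in G | (e.2 \in t) && (count (midpoints G e) t < delta)].
have -> : [set e in G | touches t e && (count (midpoints G e) t < delta)] = A1 :|: A2.
  apply/setP => e; rewrite !inE /touches.
  by case: (e \in G); case: (e.1 \in t); case: (e.2 \in t); case: (_ < _).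
apply: leq_trans (leq_card_setU _ _).1 _; rewrite -addnn mulnDr; apply: leq_add.
  rewrite card_by_snd -[X in X * _]card_ord -sum_nat_const; apply: leq_sum => x _.
  apply: low_outdegree_card => // w; rewrite !inE /= => /and3P[wx wt low].
  apply: leq_ltn_trans low; apply: card_le_count => v.
  rewrite !inE /= => /andP[/and3P[vx vt _] wv].
  by rewrite /midpoints /= vt vx wv.
rewrite card_by_fst -[X in X * _]card_ord -sum_nat_const; apply: leq_sum => x _.
apply: low_indegree_card => // w; rewrite !inE /= => /and3P[wx wt low].
apply: leq_ltn_trans low; apply: card_le_count => v.
rewrite !inE /= => /andP[/and3P[vx vt _] wv].
by rewrite /midpoints /= vt vx wv.
Qed.

(** Here [t] is already processed and [s] is the next target: an arc with [k] midpoints in [t] is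
    covered, and any other arc has few midpoints in [s]. *)
Lemma card_pass_arcs n k (G : digraph n) delta (s t : seq 'I_n) :
  simple G -> uniq t ->
  (forall e, (count (midpoints G e) s < delta) || (k <= count (midpoints G e) t)) ->
  #|pass_arcs k G s (greedy k G t set0)|
    <= n * (independence_number G * delta.*2).*2.
Proof.
move=> sG Ut h; apply: leq_trans (card_few_midpoints _ s sG); apply: subset_leq_card.
apply/subsetP => e; rewrite !inE => /and3P[-> -> nc] /=.
case/orP: (h e) => // /(covered_midpoints sG Ut) cov.
by rewrite cov ?(negbTE _) // in nc => f fG tf; apply: greedy_covers.
Qed.

(** The greedy step at [w], coming after the vertices of [t], can add the arc only in this case: [k]
    midpoints in [t] would cover it. *)
Definition late_in n k (G : digraph n) (x w : 'I_n) (t : seq 'I_n) : bool :=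
  ((w, x) \in G) && (count (midpoints G (w, x)) t < k).

Definition late_out n k (G : digraph n) (x w : 'I_n) (t : seq 'I_n) : bool :=
  ((x, w) \in G) && (count (midpoints G (x, w)) t < k).

Fixpoint late_tally (T : Type) (b : T -> seq T -> bool) (t : seq T) : nat :=
  if t is w :: t' then b w t' + late_tally b t' else 0.

(** Each arc added at the step of [w] is charged to its other endpoint [x]. *)
Lemma card_greedy n k (G : digraph n) (t : seq 'I_n) :
  simple G -> uniq t ->
  #|greedy k G t set0|
    <= \sum_(x : 'I_n) (late_tally (late_in k G x) t + late_tally (late_out k G x) t).
Proof.
move=> sG; elim: t => [|w t IHt] Ut; first by rewrite cards0.
have /andP[_ Ut'] := Ut; rewrite /= /greedy_add.
rewrite (eq_bigr (fun x => (late_tally (late_in k G x) t + late_tally (late_out k G x) t)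
   + (late_in k G x w t + late_out k G x w t))); last by move=> x _; rewrite addnACA addnC.
rewrite big_split /=; apply: leq_trans (leq_card_setU _ _).1 (leq_add (IHt Ut') _).
pose A1 := [set e in G | (e.1 == w) && (count (midpoints G e) t < k)].
pose A2 := [set e in G | (e.2 == w) && (count (midpoints G e) t < k)].
apply: (@leq_trans #|A1 :|: A2|).
  apply: subset_leq_card; apply/subsetP => e.
  rewrite !inE /touches !inE => /and3P[eG ew nc]; rewrite eG /=.
  have -> : count (midpoints G e) t < k.
    rewrite ltnNge; apply: contra nc; apply: covered_midpoints => // f fG tf.
    exact: greedy_covers.
  by rewrite !andbT.
apply: leq_trans (leq_card_setU _ _).1 _; rewrite big_split /=; apply: leq_add.
  rewrite card_by_snd; apply: leq_sum => x _; rewrite /late_in.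
  case: (boolP (_ && _)) => h.
    rewrite /= -(cards1 w); apply: subset_leq_card; apply/subsetP => v.
    by rewrite !inE => /and3P[].
  rewrite leqn0 cards_eq0; apply/eqP/setP => v; rewrite !inE /=.
  by case: eqP => [->|]; rewrite ?andbF //= (negbTE h).
rewrite card_by_fst; apply: leq_sum => x _; rewrite /late_out.
case: (boolP (_ && _)) => h.
  rewrite /= -(cards1 w); apply: subset_leq_card; apply/subsetP => v.
  by rewrite !inE => /and3P[].
rewrite leqn0 cards_eq0; apply/eqP/setP => v; rewrite !inE /=.
by case: eqP => [->|]; rewrite ?andbF //= (negbTE h).
Qed.

(** All counted vertices point to [x], so an arc from one of them to another creates a midpoint;
    each has outdegree below [k] among them. This is the bound [D] needed for the exponential
    moment. *)
Lemma count_late_in n k (G : digraph n) x (m : seq 'I_n) :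
  simple G -> uniq m ->
  count (fun w => late_in k G x w (rem w m)) m <= independence_number G * k.*2.
Proof.
move=> sG Um; rewrite -size_filter -(card_uniqP (filter_uniq _ Um)) -cardsE.
apply: low_outdegree_card => // w; rewrite inE mem_filter => /andP[/andP[wx low] wm].
apply: leq_ltn_trans low; apply: card_le_count => v.
rewrite !inE mem_filter => /andP[/andP[/andP[vx _] vm] wv].
rewrite /midpoints /= (mem_rem_uniq w Um) !inE vm wv vx !andbT /=.
by apply: contraTN wv => /eqP->; apply: simple_irrefl.
Qed.

Lemma count_late_out n k (G : digraph n) x (m : seq 'I_n) :
  simple G -> uniq m ->
  count (fun w => late_out k G x w (rem w m)) m <= independence_number G * k.*2.
Proof.
move=> sG Um; rewrite -size_filter -(card_uniqP (filter_uniq _ Um)) -cardsE.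
apply: low_indegree_card => // w; rewrite inE mem_filter => /andP[/andP[wx low] wm].
apply: leq_ltn_trans low; apply: card_le_count => v.
rewrite !inE mem_filter => /andP[/andP[/andP[vx _] vm] wv].
rewrite /midpoints /= (mem_rem_uniq w Um) !inE vm wv vx !andbT /=.
by apply: contraTN wv => /eqP->; apply: simple_irrefl.
Qed.

(** * Recovery of sparse arc sets from power sums *)

Local Open Scope ring_scope.

Definition power_sums (T : finType) (F : fieldType) (a : T -> F) m (Y : {set T}) :
    {ffun 'I_m -> F} := [ffun j : 'I_m => \sum_(e in Y) a e ^+ j].

(* A nonzero combination of at most m Vandermonde columns is nonzero: test it
   against the polynomial vanishing at all nodes but one. *)
Lemma power_sums_inj (T : finType) (F : fieldType) (a : T -> F) m (Y1 Y2 : {set T}) :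
  injective a -> (#|Y1| + #|Y2| <= m)%N ->
  power_sums a m Y1 = power_sums a m Y2 -> Y1 = Y2.
Proof.
move=> inja le_m eqs.
pose c e : F := (e \in Y1)%:R - (e \in Y2)%:R.
have c0 (j : 'I_m) : \sum_e c e * a e ^+ j = 0.
  have := congr1 (fun f : {ffun 'I_m -> F} => f j) eqs; rewrite !ffunE => /eqP.
  rewrite -subr_eq0 => /eqP E; rewrite -[RHS]E [X in _ = X - _]big_mkcond [X in _ = _ - X]big_mkcond /= -sumrB.
  by apply: eq_bigr => e _; rewrite mulrBl; do 2 case: (e \in _); rewrite ?mul1r ?mul0r.
have cp (p : {poly F}) : (size p <= m)%N -> \sum_e c e * p.[a e] = 0.
  move=> szp; under eq_bigr => e _.
    rewrite (horner_coef_wide _ szp) big_distrr /=.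
    under eq_bigr => i _ do rewrite mulrCA.
    over.
  by rewrite exchange_big big1 //= => i _; rewrite -mulr_sumr c0 mulr0.
apply/setP => e0; apply/eqP; apply: contraT => neq.
pose D := (Y1 :|: Y2) :\ e0.
pose g : {poly F} := \prod_(e in D) ('X - (a e)%:P).
have e0Y : e0 \in Y1 :|: Y2 by move: neq; rewrite inE; do 2 case: (e0 \in _).
have szg : (size g <= m)%N.
  rewrite /g -big_enum size_prod_XsubC -cardE.
  have := cardsD1 e0 (Y1 :|: Y2); rewrite e0Y -/D add1n => <-.
  exact: leq_trans (leq_card_setU _ _).1 le_m.
have := cp _ szg; rewrite (bigD1 e0) //= big1 => [|e neqe].
  rewrite addr0 => /eqP; rewrite mulf_eq0 => /orP[|].
    by rewrite /c; move: neq; do 2 case: (e0 \in _); rewrite ?subr0 ?sub0r ?oppr_eq0 ?oner_eq0.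
  rewrite horner_prod => /prodf_eq0[e]; rewrite !inE => /andP[neq' _].
  by rewrite !hornerE subr_eq0 (inj_eq inja) eq_sym (negbTE neq').
have [eD|] := boolP (e \in D).
  by rewrite horner_prod (bigD1 e) //= hornerXsubC subrr mul0r mulr0.
rewrite !inE neqe negb_or /= /c => /andP[/negbTE-> /negbTE->].
by rewrite subrr mul0r.
Qed.

(** * Good vertex orders *)

Local Open Scope nat_scope.

(** This is [(1 - 1 / rho) ^ rho <= 1 / 2] raised to the power [m], obtained from Bernoulli's
    inequality. *)
Lemma expn_half rho m : 0 < rho -> rho.-1 ^ (rho * m) * 2 ^ m <= rho ^ (rho * m).
Proof.
move=> rho0; rewrite !expnM -expnMn; case: m => // m; rewrite leq_exp2r //.
case: rho rho0 => // r _ /=.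
have h i : r ^ i * (r + i) <= r * r.+1 ^ i.
  elim: i => [|i IHi]; first by rewrite !expn0 addn0 mul1n muln1.
  rewrite !expnS; move: (r ^ i) (r.+1 ^ i) IHi => u v; nia.
have [->|r0] := posnP r; first by [].
have {}h : 2 * r ^ r <= r.+1 ^ r.
  have := h r; move: (r ^ r) (r.+1 ^ r) => u v hr.
  by rewrite -(leq_pmul2l r0); lia.
rewrite !expnS; move: (r ^ r) (r.+1 ^ r) h => u v; nia.
Qed.

(** The maximum with [k] lets the first pass start from no processed vertex and reach rank
    [rho * k]. *)
Definition next_size (n rho k a : nat) : nat := minn n (rho * maxn a k).

Lemma count_exists (T : Type) (I : finType) (E : I -> pred T) (s : seq T) :
  count (fun t => [exists i, E i t]) s <= \sum_i count (E i) s.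
Proof.
rewrite (eq_bigr (fun i => \sum_(t <- s) nat_of_bool (E i t))); last first.
  by move=> i _; rewrite -sum1_count [LHS]big_mkcond; apply: eq_bigr => t _; case: (E i t).
rewrite exchange_big -sum1_count [X in X <= _]big_mkcond; apply: leq_sum => t _.
by case: ifP => // /existsP[i Ei]; rewrite (bigD1 i) //= Ei.
Qed.

(* The factors 8 and 4 below make each failure event have probability at most
   k / n^8, respectively 1 / n^4, which beats the union bounds over all sizes and
   arcs, respectively over all vertices. *)
Definition hit_bound (n k rho : nat) := k * (rho * (8 * word_bits n)).

Definition late_bound (n k alpha : nat) := (alpha * k.*2 + 4) * word_bits n.

(* All sizes a are considered, whether or not a pass starts from them: the union
   bound over them is affordable and does not depend on the number of passes. *)
Definition good_order n k alpha rho (G : digraph n) (t : seq 'I_n) : bool :=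
  [forall a : 'I_n.+1, forall e,
     (count (midpoints G e) (suffix_of (next_size n rho k a) t) < hit_bound n k rho)
     || (k <= count (midpoints G e) (suffix_of a t))]
  && [forall x, (late_tally (late_in k G x) t < late_bound n k alpha)
                && (late_tally (late_out k G x) t < late_bound n k alpha)].

Lemma ltn_word_bits n : n < 2 ^ word_bits n.
Proof. exact: trunc_log_ltn. Qed.

(** Since [b <= rho * a], the failure probability is at most [k * (1 - 1 / rho) ^ beta], and [beta]
    is [8 * word_bits n] times [rho]. *)
Lemma count_missed_pass n k rho (G : digraph n) (a : nat) e :
  0 < k -> 0 < rho -> a <= n ->
  count (fun t => ~~ ((count (midpoints G e) (suffix_of (next_size n rho k a) t) < hit_bound n k rho)
     || (k <= count (midpoints G e) (suffix_of a t)))) (permutations (enum 'I_n))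
   * 2 ^ (8 * word_bits n) <= k * n`!.
Proof.
move=> k0 rho0 lean; set b := next_size n rho k a.
have szE : size (enum 'I_n) = n by rewrite size_enum_ord.
have bn : b <= n by apply: geq_minl.
(* For [a < k] the suffix has at most [rho * k] elements, which is below [hit_bound]. *)
have [ltak|leka] := ltnP a k.
  rewrite (@eq_in_count _ _ pred0) ?count_pred0 ?mul0n // => t.
  rewrite mem_permutations => /perm_size szt; apply/negbTE; rewrite negbK; apply/orP; left.
  apply: leq_ltn_trans (count_size _ _) _; rewrite size_suffix_of ?szt ?szE //.
  apply: leq_ltn_trans (geq_minr _ _) _; rewrite (maxn_idPr (ltnW ltak)) /hit_bound /word_bits; nia.
have bE : b = minn n (rho * a) by rewrite /b /next_size (maxn_idPl leka).
have leab : a <= b by rewrite bE; nia.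
have b0 : 0 < b by lia.
set c := count _ _; set beta := rho * (8 * word_bits n).
have h1 : c * b ^ beta <= k * (b - a) ^ beta * n`!.
  have := @count_suffix_lt _ (midpoints G e) k beta a b (enum 'I_n) (enum_uniq _) leab.
  rewrite szE => /(_ bn); apply: leq_trans; rewrite leq_mul2r; apply/orP; right.
  by apply: sub_count => t; rewrite negb_or -leqNgt -ltnNge.
have h2 : (b - a) ^ beta * rho ^ beta <= b ^ beta * rho.-1 ^ beta.
  rewrite -!expnMn; case: (beta) => // m; rewrite leq_exp2r //.
  by have : b <= rho * a by [rewrite bE geq_minr]; nia.
have h3 := expn_half (8 * word_bits n) rho0; rewrite -/beta in h3.
rewrite -(leq_pmul2r (_ : 0 < b ^ beta * rho ^ beta)); last by rewrite muln_gt0 !expn_gt0 b0 rho0.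
set E := 2 ^ _ in h3 *; set B := b ^ beta in h1 h2 *; set P := rho ^ beta in h2 h3 *.
set Q := rho.-1 ^ beta in h2 h3; set A := (b - a) ^ beta in h1 h2.
have -> : c * E * (B * P) = (c * B) * (P * E) by lia.
apply: (@leq_trans (k * A * n`! * (P * E))); first by rewrite leq_mul2r h1 orbT.
have -> : k * A * n`! * (P * E) = k * n`! * ((A * P) * E) by lia.
apply: (@leq_trans (k * n`! * ((B * Q) * E))).
  by rewrite leq_mul2l leq_mul2r h2 !orbT.
by rewrite -[B * Q * E]mulnA !leq_mul2l h3 !orbT.
Qed.

(** Union bound with [B = 2 ^ word_bits n > n]: the two kinds of failure have probability at most
    [1 / B ^ 4] and [1 / B ^ 2], which together stay below [1 / n]. *)
Lemma few_bad_orders n k alpha rho (G : digraph n) :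
  simple G -> independence_number G = alpha -> 0 < k <= n -> 0 < rho ->
  count (fun t => ~~ good_order k alpha rho G t) (permutations (enum 'I_n)) * n <= n`!.
Proof.
move=> sG aG /andP[k0 lekn] rho0.
set s := permutations _.
pose E1 (i : 'I_n.+1 * arc_of n) t :=
  ~~ ((count (midpoints G i.2) (suffix_of (next_size n rho k i.1) t) < hit_bound n k rho)
     || (k <= count (midpoints G i.2) (suffix_of i.1 t))).
pose E2 (i : 'I_n * bool) t :=
  late_bound n k alpha <= late_tally (if i.2 then late_in k G i.1 else late_out k G i.1) t.
have szE : size (enum 'I_n) = n by rewrite size_enum_ord.
have le_count : count (fun t => ~~ good_order k alpha rho G t) s <=
    \sum_i count (E1 i) s + \sum_i count (E2 i) s.
  apply: leq_trans (leq_add (count_exists E1 s) (count_exists E2 s)).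
  rewrite -count_predUI; apply: leq_trans (leq_addr _ _); apply: sub_count => t /=.
  rewrite negb_and => /orP[]; rewrite negb_forall => /existsP[x].
    by rewrite negb_forall => /existsP[e hx]; apply/orP; left; apply/existsP; exists (x, e).
  rewrite negb_and -!leqNgt => /orP[] hx; apply/orP; right; apply/existsP.
    by exists (x, true).
  by exists (x, false).
set B := 2 ^ word_bits n.
have nB : n < B := ltn_word_bits n.
have h1 : (\sum_i count (E1 i) s) * B ^ 8 <= B ^ 4 * n`!.
  apply: (@leq_trans (\sum_(i : 'I_n.+1 * arc_of n) k * n`!)).
    rewrite big_distrl; apply: leq_sum => i _ /=; rewrite -expnM mulnC [_ * 8]mulnC mulnC.
    by apply: count_missed_pass => //; rewrite -ltnS.
  rewrite sum_nat_const !card_prod !card_ord mulnA leq_mul2r; apply/orP; right.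
  (* The number of pairs of a size and an arc, times [k], is [(n + 1) * n ^ 2 * k <= B ^ 4]. *)
  have := leq_mul (leq_mul nB (leq_mul (ltnW nB) (ltnW nB))) (leq_trans lekn (ltnW nB)).
  by rewrite (_ : B * (B * B) * B = B ^ 4) // !expnS expn0; lia.
have h2 : (\sum_i count (E2 i) s) * B ^ 4 <= (n * 2) * n`!.
  apply: (@leq_trans (\sum_(i : 'I_n * bool) n`!)); last first.
    by rewrite sum_nat_const card_prod card_ord card_bool.
  rewrite big_distrl; apply: leq_sum => -[x d] _ /=; rewrite -expnM mulnC [_ * 4]mulnC mulnC.
  case: d.
    have := @count_tail_permutations _ (late_tally (late_in k G x)) (late_in k G x)
      (alpha * k.*2) (word_bits n) 4 (enum 'I_n); rewrite szE; apply=> //.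
    - by move=> w u v /permP puv; rewrite /late_in puv.
    - by move=> m Um _; rewrite -aG; apply: count_late_in.
    - exact: enum_uniq.
  have := @count_tail_permutations _ (late_tally (late_out k G x)) (late_out k G x)
    (alpha * k.*2) (word_bits n) 4 (enum 'I_n); rewrite szE; apply=> //.
  - by move=> w u v /permP puv; rewrite /late_out puv.
  - by move=> m Um _; rewrite -aG; apply: count_late_out.
  - exact: enum_uniq.
set x := \sum_i count (E1 i) s in h1 le_count.
set y := \sum_i count (E2 i) s in h2 le_count.
set z := count _ _ in le_count *; set f := n`! in h1 h2 *.
have n0 : 0 < n by lia.
have B2 : 1 < B by lia.
have hx : x * B ^ 4 <= f.
  rewrite -(leq_pmul2r (_ : 0 < B ^ 4)) ?expn_gt0 ?(ltnW B2) // -mulnA -expnD mulnC.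
  by rewrite mulnC [f * _]mulnC.
have hy : y * B ^ 2 <= f.
  rewrite -(leq_pmul2r (_ : 0 < B ^ 2)) ?expn_gt0 ?(ltnW B2) // -mulnA -expnD.
  apply: leq_trans h2 _; rewrite mulnC leq_mul2l; apply/orP; right.
  by rewrite expnS expn1; nia.
have hx' : x * B ^ 2 <= f.
  by apply: leq_trans hx; rewrite leq_mul2l leq_exp2l // orbT.
have : z * B ^ 2 <= 2 * f.
  apply: leq_trans (leq_mul le_count (leqnn _)) _; rewrite mulnDl mul2n -addnn.
  exact: leq_add.
rewrite expnS expn1 => h; rewrite -(leq_pmul2l (_ : 0 < 2)) //; apply: leq_trans h.
rewrite mulnCA leq_mul2l; apply/orP; right.
by apply: leq_mul => //; apply: ltnW.
Qed.

(** * The algorithm *)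

(** A fixed length, padded with [None], keeps the number of states at [#|option T| ^ M]; larger sets
    are truncated. *)
Definition enc_set (T : finType) (M : nat) (K : {set T}) : M.-tuple (option T) :=
  [tuple nth None (map Some (enum K)) i | i < M].

Definition dec_set (T : finType) (M : nat) (u : M.-tuple (option T)) : {set T} :=
  [set e | Some e \in u].

Lemma dec_setK (T : finType) (M : nat) (K : {set T}) :
  #|K| <= M -> dec_set (enc_set M K) = K.
Proof.
move=> leKM; apply/setP => e; rewrite inE; apply/mapP/idP => [[i _ /esym def_e]|eK].
  have [lti|gei] := ltnP i (size (enum K)); last by rewrite nth_default ?size_map in def_e.
  rewrite (nth_map e) // in def_e; case: def_e => <-.
  by rewrite -mem_enum mem_nth.
have lti : index e (enum K) < size (enum K) by rewrite index_mem mem_enum.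
have ltM : index e (enum K) < M by rewrite (leq_trans lti) // -cardE.
exists (Ordinal ltM); first by rewrite mem_enum.
by rewrite /= (nth_map e) // nth_index ?mem_enum.
Qed.

Definition max_kept (n k alpha : nat) : nat := n * (late_bound n k alpha).*2.

Definition max_sketched (n k alpha rho : nat) : nat :=
  n * (alpha * (hit_bound n k rho).*2).*2.

Definition vertex_order n (c : 'I_(n`!)) : seq 'I_n :=
  nth [::] (permutations (enum 'I_n)) c.

(** If some arc entering [X] is not kept, being covered it yields [k] kept arcs; otherwise all arcs
    of [G] entering [X] are kept. *)
Lemma certificate_rooted_conn n k (r : 'I_n) (G K : digraph n) :
  K \subset G -> (forall e, e \in G -> covered k K e) -> rooted_conn k G r -> rooted_conn k K r.
Proof.
move=> sKG cov cG X X0 rX.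
have [/exists_inP[e eG /andP[eX eK]]|] := boolP [exists e in G, enters X e && (e \notin K)].
  by move: (cov e eG); rewrite /covered (negbTE eK) /= => /forallP/(_ X); rewrite eX.
rewrite negb_exists_in => /forall_inP inK; apply: leq_trans (cG X X0 rX) _.
apply: subset_leq_card; apply/subsetP => e; rewrite !inE => /andP[eG eX].
by have := inK e eG; rewrite /enters eX /= negbK => ->.
Qed.

Lemma late_tally_suffix (T : Type) (b : T -> seq T -> bool) (s t : seq T) :
  late_tally b t <= late_tally b (s ++ t).
Proof. by elim: s => //= w s IHs; apply: leq_trans IHs (leq_addl _ _). Qed.

Lemma card_kept n k alpha rho (G : digraph n) (t : seq 'I_n) a :
  simple G -> uniq t -> good_order k alpha rho G t ->
  #|greedy k G (suffix_of a t) set0| <= max_kept n k alpha.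
Proof.
move=> sG Ut /andP[_ /forallP good].
apply: leq_trans (card_greedy _ sG _) _; first by rewrite /suffix_of drop_uniq.
rewrite /max_kept -[X in X * _]card_ord -sum_nat_const; apply: leq_sum => x _.
have /andP[h1 h2] := good x; rewrite -addnn; apply: leq_add.
  apply: leq_trans (ltnW h1); rewrite -{2}(cat_take_drop (size t - a) t).
  exact: late_tally_suffix.
apply: leq_trans (ltnW h2); rewrite -{2}(cat_take_drop (size t - a) t).
exact: late_tally_suffix.
Qed.

Lemma iter_next_size n k rho i : 0 < rho -> minn n (k * rho ^ i.+1) <= iter i.+1 (next_size n rho k) 0.
Proof.
move=> rho0; elim: i => [|i IHi].
  by rewrite /= /next_size max0n expn1 mulnC.
rewrite iterS /next_size leq_min geq_minl /=.
have [le|lt] := leqP n (k * rho ^ i.+1).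
  rewrite (minn_idPl le) in IHi; apply: leq_trans (geq_minl _ _) (leq_trans IHi _).
  exact: leq_trans (leq_maxl _ k) (leq_pmull _ rho0).
rewrite (minn_idPr (ltnW lt)) in IHi; apply: leq_trans (geq_minr _ _) _.
rewrite [rho ^ i.+2]expnS mulnCA leq_mul2l; apply/orP; right.
exact: leq_trans IHi (leq_maxl _ _).
Qed.

Lemma iter_next_size_le n k rho i : iter i (next_size n rho k) 0 <= n.
Proof. by case: i => // i; apply: geq_minl. Qed.

Lemma vertex_orderP n (c : 'I_(n`!)) : perm_eq (vertex_order c) (enum 'I_n).
Proof.
rewrite -mem_permutations mem_nth // size_permutations ?enum_uniq //.
by rewrite size_enum_ord.
Qed.

(* Random order, number of processed vertices, kept arcs, sketch. *)
Definition memory (n M m : nat) (F : finFieldType) : finType :=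
  ('I_(n`!) * 'I_n.+1 * M.-tuple (option (arc_of n)) * {ffun 'I_m -> F})%type.

Section Algorithm.

Context (n k rho M S : nat) (r : 'I_n) (F : finFieldType) (node : arc_of n -> F).
Context (token : Type) (arc : token -> arc_of n).

Implicit Types (c : 'I_(n`!)) (a : nat) (K : digraph n).

Definition batch c a : seq 'I_n :=
  take (next_size n rho k a - a) (suffix_of (next_size n rho k a) (vertex_order c)).

(** Decoding is an exhaustive search for a set of at most [S] arcs. It takes [S + S] power sums
    because uniqueness compares two such sets. *)
Definition next_kept c a K (v : {ffun 'I_(S + S) -> F}) : digraph n :=
  greedy k (odflt set0 [pick Y : digraph n | (#|Y| <= S) && (power_sums node (S + S) Y == v)])
    (batch c a) K.

Definition relevant c a K (e : arc_of n) : bool :=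
  touches (suffix_of (next_size n rho k a) (vertex_order c)) e && ~~ covered k K e.

Definition contribution c a K (e : arc_of n) : {ffun 'I_(S + S) -> F} :=
  [ffun j : 'I_(S + S) => if relevant c a K e then node e ^+ j else 0]%R.

(** The start of a pass decodes the sketch of the previous one. No such signal follows the last
    pass, so [stream_output] decodes once more. *)
Definition stream_step (q : memory n M (S + S) F) (i : option token) : memory n M (S + S) F :=
  let: (c, a, K, v) := q in
  if i is Some x then (c, a, K, v + contribution c a (dec_set K) (arc x))%R
  else (c, inord (next_size n rho k a), enc_set M (next_kept c a (dec_set K) v), 0%R).

Definition stream_output (q : memory n M (S + S) F) : {ffun 'I_k -> {set arc_of n}} :=
  let: (c, a, K, v) := q in
  odflt [ffun=> set0] [pick B | disjoint_out_branchings (next_kept c a (dec_set K) v) r B].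

Lemma orders_gt0 : 0 < #|'I_(n`!)|. Proof. by rewrite card_ord fact_gt0. Qed.

(** The outer [None] is the state before the first pass; the coin drawn on leaving it fixes the
    vertex order for good. *)
Definition branching_alg : stream_alg token {ffun 'I_k -> {set arc_of n}} :=
  StreamAlg orders_gt0 None
    (fun i c (q : option (memory n M (S + S) F)) =>
       if q is Some q' then Some (stream_step q' i)
       else if i is None then Some (c, ord0, enc_set M set0, 0%R) else None)
    (fun q => if q is Some q' then stream_output q' else [ffun=> set0]).

Lemma foldl_branching_alg q (ins : seq (option token)) (cs : seq 'I_(n`!)) :
  size cs = size ins ->
  foldl (fun s ic => step (s := branching_alg) ic.1 ic.2 s) (Some q) (zip ins cs)
    = Some (foldl stream_step q ins).
Proof. by elim: ins cs q => [|i ins IH] [|c cs] q //= [szc]; rewrite IH. Qed.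

Lemma foldl_tokens c (a : 'I_n.+1) (u : M.-tuple (option (arc_of n)))
    (v : {ffun 'I_(S + S) -> F}) (s : seq token) :
  foldl stream_step (c, a, u, v) (map Some s) =
  (c, a, u, v + \sum_(x <- s) contribution c a (dec_set u) (arc x))%R.
Proof.
elim: s v => [|x s IHs] v /=; first by rewrite big_nil GRing.addr0.
by rewrite IHs big_cons GRing.addrA.
Qed.

Lemma sum_contribution (G : digraph n) c a K :
  (\sum_(e in G) contribution c a K e)%R =
  power_sums node (S + S) (pass_arcs k G (suffix_of (next_size n rho k a) (vertex_order c)) K).
Proof.
apply/ffunP => j; rewrite sum_ffunE ffunE big_mkcond [RHS]big_mkcond /=.
apply: eq_bigr => e _; rewrite ffunE !inE /relevant.
by case: (e \in G).
Qed.

(** Goodness of the order keeps the relevant arcs within [S], so decoding returns exactly these, and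
    [greedy_pass] lets them replace [G]. *)
Lemma pass_step (G : digraph n) alpha c a (K := greedy k G (suffix_of a (vertex_order c)) set0) :
  simple G -> independence_number G = alpha -> 0 < rho -> a <= n ->
  max_sketched n k alpha rho <= S ->
  good_order k alpha rho G (vertex_order c) ->
  injective node ->
  next_kept c a K (power_sums node (S + S)
      (pass_arcs k G (suffix_of (next_size n rho k a) (vertex_order c)) K))
    = greedy k G (suffix_of (next_size n rho k a) (vertex_order c)) set0.
Proof.
move=> sG aG rho0 lean leS /andP[/forallP good _] inj.
set t := vertex_order c in K good *; set b := next_size n rho k a.
have pt : perm_eq t (enum 'I_n) := vertex_orderP c.
have szt : size t = n by rewrite (perm_size pt) size_enum_ord.
have Ut : uniq t by rewrite (perm_uniq pt) enum_uniq.
have leab : a <= b by rewrite /b /next_size; have := leq_maxl a k; nia.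
have leb : b <= n by apply: geq_minl.
have split_b : suffix_of b t = batch c a ++ suffix_of a t.
  rewrite -[LHS](cat_take_drop (b - a)) /batch -/t -/b; congr (_ ++ _).
  rewrite /suffix_of drop_drop; congr drop; lia.
set Y := pass_arcs _ _ _ _.
have cardY : #|Y| <= S.
  apply: leq_trans leS; rewrite /max_sketched -aG; apply: card_pass_arcs => //.
    by rewrite /suffix_of drop_uniq.
  have lta : a < n.+1 by [].
  by move=> e; have /forallP/(_ e) := good (Ordinal lta).
rewrite /next_kept; case: pickP => [Y' /andP[cardY' /eqP eqY]|/(_ Y)]; last first.
  by rewrite cardY eqxx.
have -> /= : Y' = Y.
  by apply: power_sums_inj inj _ eqY; apply: leq_add.
by rewrite /Y split_b greedy_pass /K /greedy foldr_cat.
Qed.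


Lemma run_passes (G : digraph n) alpha c p (s : seq token) (cs : seq 'I_(n`!)) :
  simple G -> independence_number G = alpha -> 0 < rho ->
  n <= k * rho ^ p.+1 ->
  max_kept n k alpha <= M -> max_sketched n k alpha rho <= S ->
  good_order k alpha rho G (vertex_order c) -> injective node ->
  (forall f : arc_of n -> {ffun 'I_(S + S) -> F},
     (\sum_(x <- s) f (arc x))%R = (\sum_(e in G) f e)%R) ->
  size (c :: cs) = size (passes p.+1 s) ->
  (exists B : {ffun 'I_k -> {set arc_of n}}, disjoint_out_branchings G r B) ->
  disjoint_out_branchings G r (run (A := branching_alg) (passes p.+1 s) (c :: cs)).
Proof.
move=> sG aG rho0 le_rho leM leS good inj hs [sz] [B0 hB0].
set t := vertex_order c in good.
have pt : perm_eq t (enum 'I_n) := vertex_orderP c.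
have szt : size t = n by rewrite (perm_size pt) size_enum_ord.
have Ut : uniq t by rewrite (perm_uniq pt) enum_uniq.
pose size_at i := iter i (next_size n rho k) 0.
pose kept a := greedy k G (suffix_of a t) set0.
pose sketch a := power_sums node (S + S) (pass_arcs k G (suffix_of (next_size n rho k a) t) (kept a)).
(* The state at the end of a pass begun with [a] processed vertices: the sketch is complete but not
   yet decoded. *)
pose st a : memory n M (S + S) F := (c, inord a, enc_set M (kept a), sketch a).
have decK a : dec_set (enc_set M (kept a)) = kept a.
  by rewrite dec_setK //; apply: leq_trans (card_kept a sG Ut good) leM.
have inordK' i : (inord (size_at i) : 'I_n.+1) = size_at i :> nat.
  by rewrite inordK // ltnS iter_next_size_le.
have next i : next_kept c (size_at i) (kept (size_at i)) (sketch (size_at i)) = kept (size_at i.+1).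
  exact: (pass_step sG aG rho0 (iter_next_size_le n k rho i) leS good inj).
have tokens a : a <= n -> foldl stream_step (c, inord a, enc_set M (kept a), 0%R) (map Some s) = st a.
  move=> lea; rewrite foldl_tokens GRing.add0r hs decK sum_contribution /st /sketch.
  by rewrite inordK.
have one_pass i : foldl stream_step (st (size_at i)) (None :: map Some s) = st (size_at i.+1).
  by rewrite -[RHS]tokens ?iter_next_size_le //= decK inordK' next.
have all_passes i : foldl stream_step (st (size_at 0)) (passes i s) = st (size_at i).
  elim: i => [|i IHi] //; rewrite -one_pass -IHi -foldl_cat; congr foldl.
  by rewrite /passes -addn1 nseqD flatten_cat /= cats0.
have kept0 : kept (size_at 0) = set0 by rewrite /kept /suffix_of subn0 drop_size.
(* The first pass begins with nothing to decode, so [p.+1] passes end at index [p]; the output step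
   supplies the last decoding. *)
have -> : run (A := branching_alg) (passes p.+1 s) (c :: cs) = stream_output (st (size_at p)).
  rewrite -all_passes -(tokens 0) // kept0 -foldl_cat /run /= foldl_branching_alg //.
  by congr (stream_output (foldl _ (_, _, _, _) _)); apply: val_inj; rewrite /= inordK.
rewrite /stream_output /st decK inordK' next.
have size_n : size_at p.+1 = n.
  apply/eqP; rewrite eqn_leq iter_next_size_le /=.
  by apply: leq_trans (iter_next_size n k p rho0); rewrite leq_min leqnn.
rewrite /kept size_n -[X in suffix_of X]szt suffix_of_size.
have subG : greedy k G t set0 \subset G by apply: greedy_sub; apply: sub0set.
have [] := @edmonds_branchings n k (greedy k G t set0) r.
  apply: certificate_rooted_conn subG _ (branchings_rooted_conn hB0) => e eG.
  apply: greedy_covers => //; rewrite /touches (perm_mem pt) mem_enum inE.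
  by [].
move=> B hB; case: pickP => [B' /=|/(_ B)]; last by rewrite hB.
move=> /andP[/forallP br dis]; apply/andP; split=> //; apply/forallP => i.
exact: out_branching_mono subG (br i).
Qed.

End Algorithm.

(** * Success probability and space *)

Lemma card_first_coin (C : finType) (N : nat) (Gd : {set C}) (P : pred (N.+1.-tuple C)) :
  (forall c (w : N.-tuple C), c \in Gd -> P [tuple of c :: w]) ->
  #|Gd| * #|C| ^ N <= #|[set w | P w]|.
Proof.
move=> h; rewrite -card_tuple -cardsT -cardsX.
pose f (cw : C * N.-tuple C) := [tuple of cw.1 :: cw.2].
have finj : injective f.
  by move=> [c w] [c' w'] /(congr1 val) [-> /val_inj ->].
rewrite -(card_imset _ finj); apply: subset_leq_card; apply/subsetP => _ /imsetP[[c w] cw ->].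
by move: cw; rewrite !inE /= andbT => cG; apply: h.
Qed.

(** Every good first coin contributes all its continuations. *)
Lemma success_prob_ge (R : realType) token output (A : stream_alg token output) p
    (s : seq token) (good : pred output) (Gd : {set coin A}) :
  (forall c cs, c \in Gd -> size (c :: cs) = size (passes p.+1 s) ->
     good (run (passes p.+1 s) (c :: cs))) ->
  (#|Gd|%:R / #|coin A|%:R <= success_prob R A p.+1 s good)%R.
Proof.
move=> h; rewrite /success_prob card_tuple.
set N := size (map Some s ++ passes p s).
have -> : size (passes p.+1 s) = N.+1 by [].
have le := @card_first_coin _ N Gd (fun w => good (run (passes p.+1 s) w)).
have C0 : (0 < #|coin A|%:R :> R)%R by rewrite ltr0n coin_gt0.
rewrite ler_pdivrMr // mulrAC ler_pdivlMr ?ltr0n ?expn_gt0 ?coin_gt0 //.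
rewrite -!natrM ler_nat expnSr mulnA leq_mul2r le ?orbT // => c w cG.
by apply: h => //=; rewrite size_tuple.
Qed.

Lemma card_nth_count (T : Type) (x0 : T) (s : seq T) (P : pred T) m :
  size s = m -> #|[set c : 'I_m | P (nth x0 s c)]| = count P s.
Proof.
move=> <-; rewrite -sum1_count (big_nth x0) big_mkord -sum1_card.
by apply: eq_bigl => i; rewrite inE.
Qed.

Lemma exists_injection (S T : finType) : #|S| <= #|T| -> exists f : S -> T, injective f.
Proof.
move=> le; exists (fun x => enum_val (widen_ord le (enum_rank x))).
move=> x y /enum_val_inj /(congr1 val) /= h; apply: enum_rank_inj; exact: val_inj.
Qed.

(** Each update toggles one arc, and when [x + x = 0] this adds [f e] to the sum over the current
    digraph in either case. *)
Lemma sum_updates n (V : zmodType) (f : arc_of n -> V) (G H : digraph n) s :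
  (forall x : V, x + x = 0)%R -> updates_to G H s ->
  (\sum_(x <- s) f (match x with Insert e => e | Delete e => e end)
     = \sum_(e in H) f e + \sum_(e in G) f e)%R.
Proof.
move=> VV; elim: s H => [|[e|e] s IHs] H /=.
- by move=> /eqP->; rewrite big_nil VV.
- move=> /and3P[_ eH /IHs]; rewrite big_cons => ->.
  by rewrite big_setU1 //= !addrA VV add0r.
move=> /andP[eH /IHs]; rewrite big_cons => ->.
by rewrite (big_setD1 e eH) /= addrA.
Qed.

Section Space.

Context (n k alpha rho : nat).
Let M := max_kept n k alpha.
Let S := max_sketched n k alpha rho.
(** In words: [n] for the order, one for the counter, one for the outer option, two per slot for a
    kept arc, and two for each of the [2 * S] field elements. *)
Let W := n + 2 + 2 * M + 4 * S.

Lemma space_le : 1 < n -> 1 < k -> 0 < alpha -> 0 < rho ->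
  W <= 200 * (n * alpha * k * rho * word_bits n).
Proof.
move=> n1 k1 a0 r0; rewrite /W /M /S /max_kept /max_sketched /late_bound /hit_bound.
have l0 : 0 < word_bits n by [].
move: (word_bits n) l0 => l l0; rewrite -!muln2.
set A := n * alpha * k * l.
have A0 : n <= A by rewrite /A -!mulnA leq_pmulr // !muln_gt0 a0 l0 ltnW.
have AB : A <= n * alpha * k * rho * l by rewrite /A -!mulnA !leq_mul2l leq_pmull ?orbT.
have -> : n * ((alpha * (k * 2) + 4) * l * 2) = 4 * A + 8 * (n * l) by rewrite /A; lia.
have nl : n * l * 2 <= A.
  have -> : A = n * l * (alpha * k) by rewrite /A; lia.
  by rewrite leq_mul2l (leq_trans k1) ?orbT // leq_pmull.
have -> : n * (alpha * (k * (rho * (8 * l)) * 2) * 2) = 32 * (n * alpha * k * rho * l) by lia.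
by move: (n * alpha * k * rho * l) AB => B AB; lia.
Qed.

Lemma card_memory_le (F : finFieldType) :
  #|F| = 2 ^ (2 * word_bits n) ->
  #|{: option (memory n M (S + S) F)}| <= 2 ^ (word_bits n * W).
Proof.
move=> cF; have := ltn_word_bits n; rewrite /W.
have l0 : 0 < word_bits n by [].
move: (word_bits n) l0 cF => l l0 cF nl; have {}cF : #|F| = 2 ^ (2 * l) := cF.
rewrite card_option /memory !card_prod card_tuple card_option card_prod card_ffun !card_ord cF.
have h1 : n`! <= 2 ^ (l * n).
  have fact_le m : m <= n -> m`! <= (2 ^ l) ^ m.
    elim: m => // m IHm ltm; rewrite factS expnS leq_mul ?IHm ?(ltnW ltm) //.
    exact: leq_trans ltm (ltnW nl).
  by rewrite expnM fact_le.
have h2 : ((n * n).+1) ^ M <= 2 ^ (l * (2 * M)).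
  rewrite [l * _]mulnCA mulnA expnM; case: (M) => // m; rewrite leq_exp2r //.
  by rewrite mulnC expnM; nia.
have h3 : (2 ^ (2 * l)) ^ (S + S) = 2 ^ (l * (4 * S)).
  by rewrite -expnM; congr expn; lia.
have h4 : 2 <= 2 ^ l by rewrite -[X in X <= _]expn1 leq_exp2l.
rewrite h3; have -> : l * (n + 2 + 2 * M + 4 * S) = l * n + l + l * (2 * M) + l * (4 * S) + l by lia.
rewrite !expnD.
set x := 2 ^ (l * n) in h1 *; set y := 2 ^ (l * (2 * M)) in h2 *; set z := 2 ^ (l * (4 * S)).
have P : n`! * n.+1 * (n * n).+1 ^ M * z <= x * 2 ^ l * y * z.
  by rewrite !leq_mul.
have P0 : 0 < x * 2 ^ l * y * z by rewrite !muln_gt0 !expn_gt0.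
by move: P P0 h4; move: (x * 2 ^ l * y * z) (_ * z) (2 ^ l) => p q b; nia.
Qed.

End Space.

Lemma space_words_le token output n (A : stream_alg token output) W :
  #|state A| <= 2 ^ (word_bits n * W) -> space_words n A <= W.
Proof.
move=> h; rewrite /space_words -ltnS ltn_divLR //.
have := @up_log_min 2 _ _ (isT : 1 < 2) h; have : 0 < word_bits n by [].
by move: (word_bits n) => l; nia.
Qed.

Lemma branching_algorithm (R : realType) n alpha p k rho (r : 'I_n) (token : Type)
    (arc : token -> arc_of n) (valid : digraph n -> seq token -> bool) :
  0 < p -> 1 < k -> k <= n -> 1 < n -> 0 < alpha -> 0 < rho -> n <= k * rho ^ p ->
  (forall G s, simple G -> valid G s -> forall (V : zmodType) (f : arc_of n -> V),
     (forall x : V, x + x = 0)%R -> (\sum_(x <- s) f (arc x) = \sum_(e in G) f e)%R) ->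
  exists A : stream_alg token {ffun 'I_k -> {set arc_of n}},
    finds_out_branchings_whp valid alpha p r (1 : R)%R A /\
    space_words n A <= 200 * (n * alpha * k * rho * word_bits n).
Proof.
case: p => // p _ k1 lekn n1 a0 r0 le_rho hvalid.
have l0 : 0 < 2 * word_bits n by [].
(* Characteristic 2 makes deletions act like insertions, and [2 ^ (2 * word_bits n)] elements
   suffice to label the [n * n] possible arcs injectively. *)
have [F charF cF] := pPrimePowerField (isT : prime 2) l0.
have [node inj] : exists node : arc_of n -> F, injective node.
  apply: exists_injection; rewrite card_prod card_ord cF mulnC expnM.
  by rewrite expnS expn1; apply: leq_mul; apply: ltnW; apply: ltn_word_bits.
exists (branching_alg k rho (max_kept n k alpha) (max_sketched n k alpha rho) r node arc).
split; last first.
  apply: leq_trans (space_le n1 k1 a0 r0); apply: space_words_le.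
  exact: card_memory_le.
move=> G s sG aG exB vs.
pose Gd : {set 'I_(n`!)} := [set c | good_order k alpha rho G (vertex_order c)].
have prob := @success_prob_ge R _ _ (branching_alg k rho (max_kept n k alpha)
  (max_sketched n k alpha rho) r node arc) p s (disjoint_out_branchings G r) Gd.
apply: le_trans _ (prob _) => {prob}; last first.
  move=> c cs; rewrite inE => good sz.
  apply: run_passes good inj _ sz exB => // f; apply: hvalid vs _ _ _ => //.
  by move=> x; apply/ffunP => j; rewrite !ffunE addrr_pchar2.
have fact0 : (0 < (n`!)%:R :> R)%R by rewrite ltr0n fact_gt0.
have n0 : (0 < n%:R :> R)%R by rewrite ltr0n ltnW.
rewrite /= card_ord powR_inv1 ?ler0n // ler_pdivlMr // mulrBl mul1r lerBlDr.
have bad := @few_bad_orders n k alpha rho G sG aG _ r0.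
have {}bad := bad (introT andP (conj (ltnW k1) lekn)).
have szP : size (permutations (enum 'I_n)) = n`!.
  by rewrite size_permutations ?enum_uniq // size_enum_ord.
have cG : #|Gd| + count (fun t => ~~ good_order k alpha rho G t) (permutations (enum 'I_n)) = n`!.
  by rewrite /Gd (card_nth_count [::] (good_order k alpha rho G) szP) count_predC.
rewrite -[X in (X <= _)%R](congr1 (fun m => m%:R : R)%R cG) natrD lerD2l.
by rewrite mulrC ler_pdivlMr // -natrM ler_nat.
Qed.

(** * Degenerate parameters *)

Lemma card_unit_gt0 : 0 < #|{: unit}|. Proof. by rewrite card_unit. Qed.

Definition trivial_alg token n k : stream_alg token {ffun 'I_k -> {set arc_of n}} :=
  StreamAlg card_unit_gt0 tt (fun _ _ q => q) (fun=> [ffun=> set0]).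

Lemma space_trivial_alg token n k : space_words n (trivial_alg token n k) = 0.
Proof. by rewrite /space_words card_unit up_log1 add0n divn_small. Qed.

(** Consider the cut around a single vertex other than [r]: each vertex sends at most one arc into
    it. *)
Lemma branchings_k_le n k (G : digraph n) (r : 'I_n) (F : {ffun 'I_k -> {set arc_of n}}) :
  1 < n -> disjoint_out_branchings G r F -> k <= n.
Proof.
move=> n1 /branchings_rooted_conn conn.
have [v vr] : exists v : 'I_n, r != v.
  apply/existsP; rewrite -negb_forall; apply/negP => /forallP h.
  have : #|'I_n| <= #|[set r]|.
    by rewrite -cardsT; apply: subset_leq_card; apply/subsetP => x _; rewrite inE eq_sym -[_ == _]negbK h.
  by rewrite card_ord cards1 leqNgt n1.
have v0 : [set v] != set0 by apply/set0Pn; exists v; rewrite inE.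
have := conn [set v] v0; rewrite inE vr => /(_ isT) /leq_trans; apply.
rewrite /din card_by_fst -[X in _ <= X]card_ord -sum1_card; apply: leq_sum => u _.
rewrite -(cards1 v); apply: subset_leq_card; apply/subsetP => w.
by rewrite !inE => /and3P[].
Qed.

(** For [n = 1] the required probability is 0; in the other cases no digraph satisfies the
    premises. *)
Lemma trivial_alg_whp (R : realType) token n k alpha p (r : 'I_n) (c : R)
    (valid : digraph n -> seq token -> bool) :
  (0 < c)%R -> [|| n <= 1, alpha == 0 | n < k] ->
  finds_out_branchings_whp valid alpha p r c (trivial_alg token n k).
Proof.
move=> c0 triv G s sG aG [F hF] _.
have [n1|n1] := leqP n 1.
  have eqn1 : n = 1 by have := ltn_ord r; lia.
  have -> : (n%:R `^ (- c) = 1 :> R)%R by rewrite eqn1 powR1.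
  by rewrite subrr /success_prob divr_ge0.
move: triv; rewrite leqNgt n1 /= => /orP[/eqP a0|ltnk].
  by have := independence_number_gt0 r sG; rewrite aG a0.
by have := branchings_k_le n1 hF; rewrite leqNgt ltnk.
Qed.

(** * Space bounds with real exponents *)

Local Open Scope ring_scope.

(** From [ln 2 >= 1 / 2], both [trunc_log 2 n] and 1 are at most [2 * ln n]. *)
Lemma word_bits_le (R : realType) n : (1 < n)%N -> (word_bits n)%:R <= 4 * ln (n%:R : R).
Proof.
move=> n1; have n0 : (0 < n)%N := ltnW n1.
have ln2 : 2^-1 <= ln (2 : R).
  have : ln (1 + - 2^-1 : R) <= - 2^-1 by apply: le_ln1Dx; lra.
  rewrite (_ : 1 + - 2^-1 = 2^-1 :> R); last by field.
  by rewrite lnV ?posrE // lerN2.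
have le2 m : (2 ^ m <= n)%N -> m%:R <= 2 * ln (n%:R : R).
  move=> le; have : ln ((2 ^ m)%:R : R) <= ln (n%:R : R).
    by rewrite ler_ln ?posrE ?ltr0n ?expn_gt0 // ler_nat.
  rewrite natrX lnXn // -[ln 2 *+ m]mulr_natl; have := ler_wpM2l (ler0n R m) ln2; lra.
have h1 := le2 _ (trunc_logP (isT : (1 < 2)%N) n0).
have h2 := le2 1%N n1.
rewrite /word_bits -addn1 natrD; lra.
Qed.

(** By minimality [rho - 1] violates the inequality, so it is below the root, and
    [rho <= 2 * (rho - 1)] once [rho >= 2]. Smaller [rho] use [n / k >= 1]. *)
Lemma ratio_root_le (R : realType) n k p rho :
  (0 < p)%N -> (0 < k <= n)%N -> (forall m, (n <= k * m ^ p)%N -> (rho <= m)%N) ->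
  rho%:R <= 2 * (n%:R / k%:R : R) `^ p%:R^-1.
Proof.
move=> p0 /andP[k0 lekn] min_rho.
have K0 : (0 : R) < k%:R by rewrite ltr0n.
have P0 : (0 : R) < p%:R by rewrite ltr0n.
have x1 : 1 <= (n%:R / k%:R : R) by rewrite ler_pdivlMr // mul1r ler_nat.
set x := n%:R / k%:R in x1 *.
have y1 : 1 <= x `^ p%:R^-1.
  by rewrite -[X in X <= _](powRr0 x) ler_powR // invr_ge0 ltW.
case: rho min_rho => [|[|m]] min_rho; [lra|lra|].
have : (k * m.+1 ^ p < n)%N.
  by rewrite ltnNge; apply/negP => /min_rho; rewrite ltnn.
move=> lt.
have lt' : (m.+1%:R : R) ^+ p <= x.
  by rewrite ler_pdivlMr // mulrC -natrX -natrM ler_nat ltnW.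
have : m.+1%:R <= x `^ p%:R^-1.
  have -> : (m.+1%:R : R) = (m.+1%:R ^+ p) `^ p%:R^-1.
    by rewrite -powR_mulrn // -powRrM mulfV ?gt_eqF // powRr1.
  apply: ge0_ler_powR => //; rewrite ?nnegrE ?exprn_ge0 ?invr_ge0 ?ler0n //; lra.
rewrite -[in m.+2]addn1 natrD => h; have : (1 : R) <= m.+1%:R by rewrite ler1n.
lra.
Qed.

(** Uses [k * (n / k) ^ e = k ^ (1 - e) * n ^ e]; raising the exponent from [1 / p] to [e] is
    allowed as [n / k >= 1]. The constant is [200 * 2 * 4]. *)
Lemma space_bound (R : realType) n k p rho alpha w (e : R) :
  (1 < n)%N -> (0 < p)%N -> (0 < k <= n)%N ->
  (forall m, (n <= k * m ^ p)%N -> (rho <= m)%N) ->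
  p%:R^-1 <= e ->
  (w <= 200 * (n * alpha * k * rho * word_bits n))%N ->
  w%:R <= 1600 * (k%:R `^ (1 - e) * alpha%:R * n%:R `^ (1 + e) * ln (n%:R : R)).
Proof.
move=> n1 p0 kn min_rho lee le_w; have /andP[k0 lekn] := kn.
have K0 : (0 : R) < k%:R by rewrite ltr0n.
have N0 : (0 : R) < n%:R by rewrite ltr0n ltnW.
have hr := @ratio_root_le R n k p rho p0 kn min_rho.
have hl := word_bits_le R n1.
have x1 : 1 <= (n%:R / k%:R : R) by rewrite ler_pdivlMr // mul1r ler_nat.
have {}hr : rho%:R <= 2 * (n%:R / k%:R : R) `^ e.
  by apply: le_trans hr _; rewrite ler_pM2l // ler_powR.
apply: (@le_trans _ _ (200 * (n * alpha * k * rho * word_bits n))%:R).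
  by rewrite ler_nat.
have powD (x f : R) : 0 < x -> x `^ (1 + f) = x * x `^ f.
  by move=> x0; rewrite powRD ?powRr1 ?(ltW x0) // (gt_eqF x0) implybT.
rewrite !powD // powRN.
rewrite powRM ?invr_ge0 ?ler0n // -[k%:R^-1]powR_inv1 ?ler0n // -powRrM mulN1r powRN in hr.
move: hr; set u := n%:R `^ e; set v := (k%:R `^ e)^-1 => hr.
rewrite !natrM.
have -> : 1600 * (k%:R * v * alpha%:R * (n%:R * u) * ln n%:R) =
  200 * (n%:R * alpha%:R * k%:R) * ((2 * (u * v)) * (4 * ln n%:R)) :> R by ring.
have -> : 200%:R * (n%:R * alpha%:R * k%:R * rho%:R * (word_bits n)%:R) =
  200 * (n%:R * alpha%:R * k%:R) * (rho%:R * (word_bits n)%:R) :> R by ring.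
apply: ler_wpM2l; first by rewrite !mulr_ge0.
by apply: ler_pM.
Qed.

Lemma streaming_branchings (R : realType) n alpha p k (r : 'I_n) (token : Type)
    (arc : token -> arc_of n) (valid : digraph n -> seq token -> bool) (e : R) :
  (0 < p)%N -> (1 < k)%N -> p%:R^-1 <= e ->
  (forall G s, simple G -> valid G s -> forall (V : zmodType) (f : arc_of n -> V),
     (forall x : V, x + x = 0) -> \sum_(x <- s) f (arc x) = \sum_(e in G) f e) ->
  exists A : stream_alg token {ffun 'I_k -> {set arc_of n}},
    finds_out_branchings_whp valid alpha p r (1 : R) A /\
    (space_words n A)%:R <=
      1600 * (k%:R `^ (1 - e) * alpha%:R * n%:R `^ (1 + e) * ln (n%:R : R)).
Proof.
move=> p0 k1 lee hvalid.
have [triv|] := boolP [|| n <= 1, alpha == 0 | n < k]%N.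
  exists (trivial_alg token n k); split; first exact: trivial_alg_whp.
  rewrite space_trivial_alg !mulr_ge0 ?powR_ge0 // ln_ge0 //.
  by rewrite ler1n; apply: leq_ltn_trans (ltn_ord r).
rewrite !negb_or -!ltnNge -lt0n => /and3P[n1 a0 lekn].
have ex_rho : exists m, (n <= k * m ^ p)%N.
  exists n; apply: (@leq_trans (n ^ p)); last by rewrite leq_pmull // ltnW.
  by rewrite -[X in (X <= _)%N]expn1 leq_pexp2l // ltnW.
case: (ex_minnP ex_rho) => rho le_rho min_rho.
have rho0 : (0 < rho)%N.
  by rewrite lt0n; apply: contraTneq le_rho => ->; rewrite exp0n // muln0 -ltnNge ltnW.
have [A [whp sp]] := branching_algorithm R r p0 k1 lekn n1 a0 rho0 le_rho hvalid.
exists A; split=> //; apply: space_bound min_rho lee sp => //.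
by rewrite (ltnW k1).
Qed.

Theorem theorem6p1 (R : realType) :
  (exists C c : R, 0 < C /\ 0 < c /\
    forall (n alpha p k : nat) (r : 'I_n), (1 <= p)%N -> (2 <= k)%N ->
    exists A : stream_alg (arc_of n) {ffun 'I_k -> {set arc_of n}},
      finds_out_branchings_whp (@insertion_stream n) alpha p r c A /\
      (space_words n A)%:R <=
        C * (k%:R `^ (1 - 1 / p%:R) * alpha%:R * n%:R `^ (1 + 1 / p%:R) * ln n%:R))
  /\
  (exists C c d : R, 0 < C /\ 0 < c /\ 0 < d /\
    forall (n alpha p k : nat) (r : 'I_n), (1 <= p)%N -> (2 <= k)%N ->
    exists A : stream_alg (update n) {ffun 'I_k -> {set arc_of n}},
      finds_out_branchings_whp (@turnstile_stream n) alpha p r c A /\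
      (space_words n A)%:R <=
        C * (k%:R `^ (1 - d / Num.sqrt p%:R) * alpha%:R
             * n%:R `^ (1 + d / Num.sqrt p%:R) * ln n%:R)).
Proof.
split.
  exists 1600, 1; split=> //; split=> // n alpha p k r p1 k2.
  apply: (@streaming_branchings R n alpha p k r _ id) => //; first by rewrite div1r.
  move=> G s _ hs V f _; rewrite (perm_big _ hs) /=.
  by rewrite big_enum.
exists 1600, 1, 1; do 3 split=> //; move=> n alpha p k r p1 k2.
apply: (@streaming_branchings R n alpha p k r _
  (fun u => match u with Insert e => e | Delete e => e end)) => //.
  (* Since [1 / p <= 1 / sqrt p], the exponent [e = 1 / sqrt p] is admissible, with [d = 1]. *)
  have p1R : (1 : R) <= p%:R by rewrite ler1n.
  rewrite div1r lef_pV2 ?posrE ?sqrtr_gt0 ?ltr0n //.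
  rewrite -[X in _ <= X]sqr_sqrtr ?ler0n // expr2 ler_peMl ?sqrtr_ge0 //.
  by rewrite -[X in X <= _]sqrtr1 ler_sqrt // ltr0n.
move=> G s _ hs V f VV; rewrite (sum_updates f VV hs) big_set0 add0r.
by [].
Qed.
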